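(* Let $C$ be a simple closed contour with bounded interior $\mathcal{D}^+$ and exterior $\mathcal{D}^-$, let $n\ge 0$ be an integer, and let $F$ be a complement function of order $n$ with respect to $C$. Suppose that for all $0\le k\le n$ $$\frac{-1}{2\pi i}\oint_C\frac{F^{(k)}(t)}{t-z}\,dt=F^{(k)}(z)\quad(z\in\mathcal{D}^-),\qquad \frac{-1}{2\pi i}\oint_C\frac{F^{(k)}(t)}{t-z}\,dt=0\quad(z\in\mathcal{D}^+).$$ Then $F$ and its derivatives $F^{(k)}$, $0\le k\le n$, are uniformly continuous in the closed domain $\overline{\mathcal{D}^-}=\mathcal{D}^-\cup C$, and their integral formulas converge uniformly in the closed domains; that is, writing $J_k^-[F(z)]=\frac{-1}{2\pi i}\oint_C\frac{F^{(k)}(t)}{t-z}\,dt$ for $z\notin C$, the limits as $z_\pm\in\mathcal{D}^\pm$ tends to $z_0\in C$, $$\lim_{z_\pm\to z_0}J_k^-[F(z_\pm)]=\mp\frac12F^{(k)}(z_0)-\frac{1}{2\pi i}\,\mathcal{P}\oint_C\frac{F^{(k)}(t)}{t-z_0}\,dt,$$ exist, uniformly in $z_0\in C$, and, when $J_k^-[F]$ is extended to $C$ by its limit from the $\mathcal{D}^-$ side, $J_k^-[F(z)]-F^{(k)}(z)=0$ for all $z\in\overline{\mathcal{D}^-}$, while when it is extended to $C$ by its limit from the $\mathcal{D}^+$ side, $J_k^-[F(z)]=0$ for all $z\in\overline{\mathcal{D}^+}=\mathcal{D}^+\cup C$.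
   Context: $C$ is a simple closed regular (smooth) curve in the complex plane, traversed counterclockwise; all integrals over $C$ are taken counterclockwise. $\mathcal{D}^+$ is the simply connected open domain bounded by $C$, and $\mathcal{D}^-$ is the open domain outside $C$. A complement function of order $n$ with respect to $C$ is a single-valued holomorphic function $F$ that is $n$ times continuously (complex) differentiable in $\mathcal{D}^-$ and in a neighborhood of $C$ (a neighborhood striding across $C$), and satisfies $F(z)=O(|z|^{-m})$ for some $m\ge 2$ as $|z|\to\infty$. $F^{(0)}=F$. The symbol $\mathcal{P}$ denotes the Cauchy principal value at $t=z_0$: the limit as $\epsilon\to0^+$ of the integral over the part of $C$ with $|t-z_0|\ge\epsilon$. *)

(* Defs.v *)
From Stdlib Require Import Reals ClassicalEpsilon.
From Coquelicot Require Import Coquelicot.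

Open Scope R_scope.

(** A simple closed regular curve of class C^1, parametrized by a periodic
    function on the whole line, so that the tangent also closes up. *)
Record jordan_curve := JordanCurve {
  gam : R -> C;
  dgam : R -> C;
  period : R;
  period_gt0 : 0 < period;
  gam_derive : forall s, @is_derive R_AbsRing C_R_NormedModule gam s (dgam s);
  dgam_continuous : forall s, continuous dgam s;
  gam_regular : forall s, dgam s <> 0%C;
  gam_periodic : forall s, gam (s + period) = gam s;
  gam_simple : forall s t, 0 <= s < period -> 0 <= t < period ->
    gam s = gam t -> s = t
}.

Definition on_curve (c : jordan_curve) (z : C) : Prop := exists s, gam c s = z.

Definition connected_set (A : C -> Prop) : Prop :=
  forall U V : C -> Prop, open U -> open V ->
    (forall z, A z -> U z \/ V z) ->
    (exists z, A z /\ U z) -> (exists z, A z /\ V z) ->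
    exists z, A z /\ U z /\ V z.

(** [same_component c z w]: [w] lies in the connected component of [z] in the
    complement of the curve. *)
Definition same_component (c : jordan_curve) (z w : C) : Prop :=
  exists A : C -> Prop, connected_set A /\ (forall u, A u -> ~ on_curve c u) /\
    A z /\ A w.

Definition bounded_component (c : jordan_curve) (z : C) : Prop :=
  exists M : R, forall w, same_component c z w -> Cmod w <= M.

Definition inside (c : jordan_curve) (z : C) : Prop :=
  ~ on_curve c z /\ bounded_component c z.

Definition outside (c : jordan_curve) (z : C) : Prop :=
  ~ on_curve c z /\ ~ bounded_component c z.

Definition closed_inside (c : jordan_curve) (z : C) : Prop :=
  inside c z \/ on_curve c z.

Definition closed_outside (c : jordan_curve) (z : C) : Prop :=
  outside c z \/ on_curve c z.

Definition is_contour_int (c : jordan_curve) (g : C -> C) (v : C) : Prop :=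
  @is_RInt C_R_NormedModule (fun s => (g (gam c s) * dgam c s)%C)
    0 (period c) v.

(** The value of [is_contour_int], taken componentwise since [RInt] needs a
    complete normed module over [R] and [C] carries no such instance. *)
Definition contour_int (c : jordan_curve) (g : C -> C) : C :=
  (RInt (fun s => fst (g (gam c s) * dgam c s)%C) 0 (period c),
   RInt (fun s => snd (g (gam c s) * dgam c s)%C) 0 (period c)).

(** Winding number 1 around every interior point. *)
Definition counterclockwise (c : jordan_curve) : Prop :=
  forall z, inside c z ->
    (/ (2 * PI * Ci) * contour_int c (fun t => / (t - z)))%C = 1%C.

(** Cauchy principal value at [z0]; the truncated integrals are required to
    exist for all small [eps > 0]. *)
Definition is_pv (c : jordan_curve) (g : C -> C) (z0 v : C) : Prop :=
  filterlimi
    (fun (eps : R) (w : C) =>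
       is_contour_int c
         (fun t => if Rle_dec eps (Cmod (t - z0)) then g t else 0%C) w)
    (at_right 0) (locally v).

Definition Cderive_n (k : nat) (F : C -> C) : C -> C := Nat.iter k C_derive F.

Definition complement_function (c : jordan_curve) (n : nat) (F : C -> C)
    : Prop :=
  (exists N : C -> Prop, open N /\ (forall z, on_curve c z -> N z) /\
     forall z, outside c z \/ N z ->
       ex_derive F z /\
       (forall k, (k < n)%nat -> ex_derive (Cderive_n k F) z) /\
       (forall k, (k <= n)%nat -> continuous (Cderive_n k F) z)) /\
  (exists (m : nat) (M r : R), (2 <= m)%nat /\ 0 < r /\
     forall z, r <= Cmod z -> Cmod (F z) <= M / Cmod z ^ m).

Definition J_minus (c : jordan_curve) (F : C -> C) (k : nat) (z : C) : C :=
  (- 1 / (2 * PI * Ci) * contour_int c (fun t => Cderive_n k F t / (t - z)))%C.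

Definition unif_continuous_on (A : C -> Prop) (f : C -> C) : Prop :=
  forall eps, 0 < eps -> exists delta, 0 < delta /\
    forall z w, A z -> A w -> Cmod (z - w) < delta -> Cmod (f z - f w) < eps.

(** [f z -> L z0] as [z] in [D] tends to [z0], uniformly in [z0] on the curve. *)
Definition unif_limit_on_curve (c : jordan_curve) (D : C -> Prop)
    (f L : C -> C) : Prop :=
  forall eps, 0 < eps -> exists delta, 0 < delta /\
    forall z0 z, on_curve c z0 -> D z ->
      Cmod (z - z0) < delta -> Cmod (f z - L z0) < eps.

(** [f], with its values on the curve replaced by its limits from within [D]. *)
Definition extend_from (c : jordan_curve) (D : C -> Prop) (f : C -> C) (z : C)
    : C :=
  if excluded_middle_informative (on_curve c z)
  then @iota C_CompleteNormedModule
         (fun l : C => filterlim f (within D (locally z)) (locally l))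
  else f z.

(* Main.v *)
Require Import Defs.
From Stdlib Require Import Reals ZArith Lra Lia ClassicalEpsilon.
From Coquelicot Require Import Coquelicot.
Open Scope R_scope.

(** Write [f] for one of the derivatives of [F] and [I z] for the contour
    integral of [f t / (t - z)]. The hypotheses say that [I] vanishes inside
    the curve and equals [- (2 * PI * Ci) * f z] outside, and [f] is continuous
    across the curve; hence both one-sided limits of [I] at a point [z0] of the
    curve are known, namely [0] and [- (2 * PI * Ci) * f z0]. The principal
    value is their mean, [- (PI * Ci) * f z0], and with this value the two
    formulas for the limits of [J_minus] reduce to [0] and [f z0].

    That the principal value exists and is this mean is
    [principal_value_of_limits]. Let [z0 + h * Ci * g0] and
    [z0 - h * Ci * g0] be symmetric points on the normal at [z0], where [g0] is the velocity there. The sum of the Cauchy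
    kernels at these points, less twice the Cauchy kernel at [z0] truncated at
    distance [h * Cmod g0], has bounded total mass concentrated at [z0], and
    is nearly odd, so its integral against a continuous density tends to [0]
    ([symmetric_limit]). In the coordinate [u] in which the curve passes
    through [0] with velocity [1], this is seen by comparing each kernel with
    the one on the straight line, all errors being small multiples of the
    Poisson kernel ([near_symmetric], [concentrated_integral]). The truncated
    integral exists because the curve leaves small discs around [z0] exactly
    once on either side ([truncation_interval], [local_u_mono]).

    For this one must know that the two normal points lie on different sides.
    The winding number is constant on connected sets off the curve, because
    its first-order variation is the integral of an exact form
    ([winding_second_order]); it is [0] outside, where the component reaches
    infinity, and [1] inside, by orientation. The difference of the kernels at
    the two normal points is nearly a Poisson kernel, so the winding number
    increases by [1] from right to left ([winding_jump]), which forces the left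
    point inside and the right point outside ([normal_points_sides]). In
    particular both domains accumulate at each point of the curve, so the
    one-sided limits in the extensions are unique, and the inside is open, so
    the closed exterior is closed.

    Uniform continuity of [f] on the closed exterior follows from continuity,
    compactness, and the decay of the Cauchy integral at infinity
    ([cauchy_integral_decay], [unif_continuous_of_decay]); it also makes the
    limit from outside uniform along the curve. *)

(** * Complex-valued functions *)

Lemma RtoC_neq : forall x y : R, x <> y -> RtoC x <> RtoC y.
Proof. intros x y Hxy H. apply Hxy, RtoC_inj, H. Qed.

Lemma Cmod_triangle_sub : forall a b : C, Cmod a - Cmod b <= Cmod (a - b)%C.
Proof.
  intros a b. generalize (Cmod_triangle (a - b)%C b).
  replace (a - b + b)%C with a by ring. lra.
Qed.

Lemma Cmod_sub_sym : forall a b : C, Cmod (a - b)%C = Cmod (b - a)%C.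
Proof. intros a b. rewrite <- Cmod_opp. f_equal. ring. Qed.

Lemma Cmod_sub_le : forall a b : C, Cmod (a - b)%C <= Cmod a + Cmod b.
Proof.
  intros a b. unfold Cminus. rewrite <- (Cmod_opp b). apply Cmod_triangle.
Qed.

Lemma snd_le_Cmod : forall c : C, Rabs (snd c) <= Cmod c.
Proof. intros c. eapply Rle_trans; [apply Rmax_r | apply Rmax_Cmod]. Qed.

Lemma fst_le_Cmod : forall c : C, Rabs (fst c) <= Cmod c.
Proof. intros c. apply re_le_Cmod. Qed.

Lemma Cmod_le_sum : forall c : C, Cmod c <= Rabs (fst c) + Rabs (snd c).
Proof.
  intros [x y]. unfold Cmod; simpl.
  assert (Hx := Rabs_pos x). assert (Hy := Rabs_pos y).
  rewrite <- (sqrt_Rsqr (Rabs x + Rabs y)) by lra.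
  apply sqrt_le_1_alt. unfold Rsqr.
  replace (x * (x * 1)) with (Rabs x * Rabs x)
    by (rewrite <- Rabs_mult, Rabs_right; [ring | nra]).
  replace (y * (y * 1)) with (Rabs y * Rabs y)
    by (rewrite <- Rabs_mult, Rabs_right; [ring | nra]).
  nra.
Qed.

Lemma norm_C_R : forall x : C, @norm R_AbsRing C_R_NormedModule x = Cmod x.
Proof.
  intros [x y]. unfold norm; simpl. unfold prod_norm, Cmod; simpl.
  f_equal. unfold norm; simpl. unfold abs; simpl.
  rewrite !Rmult_1_r, <- !Rabs_mult, !Rabs_right; nra.
Qed.

Lemma ball_Cmod : forall (z w : C) (e : posreal),
  Cmod (w - z)%C < e -> @ball C_UniformSpace z e w.
Proof.
  intros z w e H. split.
  - eapply Rle_lt_trans; [apply (fst_le_Cmod (w - z)%C) | exact H].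
  - eapply Rle_lt_trans; [apply (snd_le_Cmod (w - z)%C) | exact H].
Qed.

Lemma Cmod_ball : forall (z w : C) (e : posreal),
  @ball C_UniformSpace z e w -> Cmod (w - z)%C < 2 * e.
Proof.
  intros z w e [H1 H2].
  eapply Rle_lt_trans; [apply Cmod_le_sum|].
  change (Rabs (fst w - fst z) < e) in H1.
  change (Rabs (snd w - snd z) < e) in H2.
  change (Rabs (fst w - fst z) + Rabs (snd w - snd z) < 2 * e). lra.
Qed.

(** Neighbourhoods come from the product structure of the plane, whose balls
    are squares; this and the next lemma translate them to round discs. *)
Lemma locally_disc : forall (z : C) (P : C -> Prop),
  @locally C_UniformSpace z P ->
  exists d, 0 < d /\ forall w, Cmod (w - z)%C < d -> P w.
Proof.
  intros z P [e He]. exists e. split; [apply cond_pos|].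
  intros w Hw. apply He, ball_Cmod, Hw.
Qed.

Lemma disc_locally : forall (z : C) (P : C -> Prop) d,
  0 < d -> (forall w, Cmod (w - z)%C < d -> P w) ->
  @locally C_UniformSpace z P.
Proof.
  intros z P d Hd H.
  assert (H2 : 0 < d / 2) by lra.
  exists (mkposreal _ H2). intros w Hw. apply H.
  apply Cmod_ball in Hw. simpl in Hw. lra.
Qed.

Lemma continuous_disc : forall (f : C -> C) (z : C),
  @continuous C_UniformSpace C_UniformSpace f z ->
  forall e, 0 < e ->
  exists d, 0 < d /\ forall w, Cmod (w - z)%C < d -> Cmod (f w - f z)%C < e.
Proof.
  intros f z Hf e He. apply locally_disc.
  apply (Hf (fun w => Cmod (w - f z)%C < e)). apply disc_locally with (d := e); auto.
Qed.

Lemma continuous_disc_R : forall (f : R -> C) (x : R),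
  @continuous R_UniformSpace C_UniformSpace f x ->
  forall e, 0 < e ->
  exists d, 0 < d /\ forall y, Rabs (y - x) < d -> Cmod (f y - f x)%C < e.
Proof.
  intros f x Hf e He.
  assert (Hl : @locally R_UniformSpace x (fun y => Cmod (f y - f x)%C < e)).
  { apply (Hf (fun w => Cmod (w - f x)%C < e)). apply disc_locally with (d := e); auto. }
  destruct Hl as [d Hd]. exists d. split; [apply cond_pos|].
  intros y Hy. apply Hd, Hy.
Qed.

Section Continuity.
Context {U : UniformSpace}.
Implicit Types f g : U -> C.

Local Notation cc f x := (@continuous U C_UniformSpace f x).

Lemma continuous_Cfst : forall f x, cc f x -> continuous (fun y => fst (f y)) x.
Proof.
  intros f x Hf. apply (continuous_comp f fst); auto.
  rewrite (surjective_pairing (f x)). apply continuous_fst.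
Qed.

Lemma continuous_Csnd : forall f x, cc f x -> continuous (fun y => snd (f y)) x.
Proof.
  intros f x Hf. apply (continuous_comp f snd); auto.
  rewrite (surjective_pairing (f x)). apply continuous_snd.
Qed.

Lemma continuous_Cpair : forall f x,
  continuous (fun y => fst (f y)) x -> continuous (fun y => snd (f y)) x ->
  cc f x.
Proof.
  intros f x H1 H2. intros P HP. apply locally_disc in HP.
  destruct HP as [d [Hd HP]].
  assert (Hd2 : 0 < d / 2) by lra.
  assert (A1 := H1 _ (locally_ball (fst (f x)) (mkposreal _ Hd2))).
  assert (A2 := H2 _ (locally_ball (snd (f x)) (mkposreal _ Hd2))).
  unfold filtermap in *.
  generalize (filter_and _ _ A1 A2). apply filter_imp.
  intros y [B1 B2]. apply HP.
  change (Rabs (fst (f y) - fst (f x)) < d / 2) in B1.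
  change (Rabs (snd (f y) - snd (f x)) < d / 2) in B2.
  eapply Rle_lt_trans; [apply Cmod_le_sum|].
  change (Rabs (fst (f y) - fst (f x)) + Rabs (snd (f y) - snd (f x)) < d).
  lra.
Qed.

Lemma continuous_Cconst : forall (a : C) x, cc (fun _ => a) x.
Proof. intros. apply continuous_const. Qed.

Lemma continuous_Cplus : forall f g x, cc f x -> cc g x ->
  cc (fun y => (f y + g y)%C) x.
Proof.
  intros f g x Hf Hg. apply continuous_Cpair; simpl.
  - apply @continuous_plus; apply continuous_Cfst; auto.
  - apply @continuous_plus; apply continuous_Csnd; auto.
Qed.

Lemma continuous_Copp : forall f x, cc f x -> cc (fun y => (- f y)%C) x.
Proof.
  intros f x Hf. apply continuous_Cpair; simpl.
  - apply @continuous_opp; apply continuous_Cfst; auto.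
  - apply @continuous_opp; apply continuous_Csnd; auto.
Qed.

Lemma continuous_Cminus : forall f g x, cc f x -> cc g x ->
  cc (fun y => (f y - g y)%C) x.
Proof.
  intros. apply continuous_Cplus; auto. apply continuous_Copp; auto.
Qed.

Lemma continuous_Cmult : forall f g x, cc f x -> cc g x ->
  cc (fun y => (f y * g y)%C) x.
Proof.
  intros f g x Hf Hg.
  assert (F1 := continuous_Cfst _ _ Hf). assert (F2 := continuous_Csnd _ _ Hf).
  assert (G1 := continuous_Cfst _ _ Hg). assert (G2 := continuous_Csnd _ _ Hg).
  apply continuous_Cpair; simpl.
  - apply @continuous_minus; apply @continuous_mult; auto.
  - apply @continuous_plus; apply @continuous_mult; auto.
Qed.

Lemma continuous_Cinv : forall f x, cc f x -> f x <> 0%C ->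
  cc (fun y => (/ f y)%C) x.
Proof.
  intros f x Hf Hn.
  assert (F1 := continuous_Cfst _ _ Hf). assert (F2 := continuous_Csnd _ _ Hf).
  assert (Hp : fst (f x) ^ 2 + snd (f x) ^ 2 <> 0).
  { intros H0. apply Hn. destruct (f x) as [a b]; simpl in *.
    apply injective_projections; simpl; nra. }
  assert (Hi : continuous (fun y => / (fst (f y) ^ 2 + snd (f y) ^ 2)) x).
  { apply continuous_comp with (g := Rinv)
      (f := fun y => fst (f y) ^ 2 + snd (f y) ^ 2).
    - apply @continuous_plus.
      + apply continuous_ext with (fun y => mult (fst (f y)) (fst (f y))).
        { intros; unfold mult; simpl; ring. }
        apply @continuous_mult; auto.
      + apply continuous_ext with (fun y => mult (snd (f y)) (snd (f y))).
        { intros; unfold mult; simpl; ring. }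
        apply @continuous_mult; auto.
    - apply continuous_Rinv, Hp. }
  apply continuous_Cpair; simpl.
  - apply (continuous_mult _ _ _ F1 Hi).
  - apply (continuous_mult (fun y => - snd (f y))); auto.
    apply @continuous_opp; auto.
Qed.

Lemma continuous_Cdiv : forall f g x, cc f x -> cc g x -> g x <> 0%C ->
  cc (fun y => (f y / g y)%C) x.
Proof.
  intros. apply continuous_Cmult; auto. apply continuous_Cinv; auto.
Qed.

Lemma continuous_Cmod : forall f x, cc f x -> continuous (fun y => Cmod (f y)) x.
Proof.
  intros f x Hf P [e He].
  assert (A := Hf _ (disc_locally (f x) _ e (cond_pos e) (fun w H => H))).
  unfold filtermap in *. revert A. apply filter_imp. intros y Hy.
  apply He. change (Rabs (Cmod (f y) - Cmod (f x)) < e).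
  apply Rabs_def1.
  - generalize (Cmod_triangle_sub (f y) (f x)). lra.
  - generalize (Cmod_triangle_sub (f x) (f y)). rewrite Cmod_sub_sym. lra.
Qed.

End Continuity.

Lemma continuous_attains_min : forall (f : R -> R) a b, a <= b ->
  (forall x, a <= x <= b -> continuous f x) ->
  exists x0, a <= x0 <= b /\ forall x, a <= x <= b -> f x0 <= f x.
Proof.
  intros f a b Hab Hf.
  destruct (continuity_ab_min f a b Hab) as [x0 [H1 H2]].
  - intros x Hx. apply continuity_pt_filterlim. apply Hf, Hx.
  - exists x0; split; auto.
Qed.

Lemma continuous_bounded : forall (f : R -> C) a b,
  (forall x, a <= x <= b -> @continuous R_UniformSpace C_UniformSpace f x) ->
  exists B, 0 < B /\ forall x, a <= x <= b -> Cmod (f x) <= B.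
Proof.
  intros f a b Hf. destruct (Rle_dec a b) as [Hab|Hab].
  - destruct (continuous_attains_min (fun x => - Cmod (f x)) a b Hab)
      as [x0 [H1 H2]].
    + intros x Hx. apply @continuous_opp. apply continuous_Cmod, Hf, Hx.
    + exists (Cmod (f x0) + 1). split.
      * generalize (Cmod_ge_0 (f x0)); lra.
      * intros x Hx. specialize (H2 x Hx). lra.
  - exists 1. split; [lra|]. intros x Hx. lra.
Qed.

Lemma is_derive_Cfst : forall (f : R -> C) (x : R) (l : C),
  @is_derive R_AbsRing C_R_NormedModule f x l ->
  is_derive (fun y => fst (f y)) x (fst l).
Proof.
  intros f x l Hf.
  apply (filterdiff_comp' f (fun z : C_R_NormedModule => fst z) x
    (fun y => scal y l) (fun z => fst z)); auto.
  apply filterdiff_linear. exact (@is_linear_fst R_AbsRing R_NormedModule R_NormedModule).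
Qed.

Lemma is_derive_Csnd : forall (f : R -> C) (x : R) (l : C),
  @is_derive R_AbsRing C_R_NormedModule f x l ->
  is_derive (fun y => snd (f y)) x (snd l).
Proof.
  intros f x l Hf.
  apply (filterdiff_comp' f (fun z : C_R_NormedModule => snd z) x
    (fun y => scal y l) (fun z => snd z)); auto.
  apply filterdiff_linear. exact (@is_linear_snd R_AbsRing R_NormedModule R_NormedModule).
Qed.

Lemma is_derive_Cbound : forall (f : R -> C) (x : R) (l : C),
  @is_derive R_AbsRing C_R_NormedModule f x l ->
  forall e, 0 < e -> exists d, 0 < d /\ forall y, Rabs (y - x) < d ->
    Cmod (f y - f x - (y - x)%R * l)%C <= e * Rabs (y - x).
Proof.
  intros f x l [_ Hf] e He.
  specialize (Hf x (fun P H => H) (mkposreal e He)).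
  destruct Hf as [d Hd]. exists d. split; [apply cond_pos|].
  intros y Hy. specialize (Hd y Hy).
  rewrite norm_C_R in Hd. simpl in Hd.
  replace (f y - f x - (y - x)%R * l)%C
    with (minus (minus (f y) (f x)) (scal (minus y x) l)
          : C_R_NormedModule).
  - exact Hd.
  - unfold minus, plus, opp, scal; simpl.
    unfold prod_plus, prod_opp, prod_scal; simpl.
    unfold plus, opp, scal; simpl. unfold mult; simpl.
    apply injective_projections; simpl; ring.
Qed.

(** * Integrals of complex-valued functions of a real variable *)

Definition is_CInt (f : R -> C) (a b : R) (v : C) : Prop :=
  @is_RInt C_R_NormedModule f a b v.

Lemma is_CInt_pair : forall (f : R -> C) a b (v : C),
  is_RInt (fun x => fst (f x)) a b (fst v) ->
  is_RInt (fun x => snd (f x)) a b (snd v) -> is_CInt f a b v.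
Proof.
  intros f a b v H1 H2. rewrite (surjective_pairing v).
  exact (@is_RInt_fct_extend_pair R_NormedModule R_NormedModule f a b _ _ H1 H2).
Qed.

Lemma is_CInt_fst : forall (f : R -> C) a b (v : C),
  is_CInt f a b v -> is_RInt (fun x => fst (f x)) a b (fst v).
Proof.
  intros f a b v.
  exact (@is_RInt_fct_extend_fst R_NormedModule R_NormedModule f a b v).
Qed.

Lemma is_CInt_snd : forall (f : R -> C) a b (v : C),
  is_CInt f a b v -> is_RInt (fun x => snd (f x)) a b (snd v).
Proof.
  intros f a b v.
  exact (@is_RInt_fct_extend_snd R_NormedModule R_NormedModule f a b v).
Qed.

Lemma CInt_components : forall (f : R -> C) a b (v : C),
  is_CInt f a b v ->
  (RInt (fun x => fst (f x)) a b, RInt (fun x => snd (f x)) a b) = v.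
Proof.
  intros f a b v H. rewrite (surjective_pairing v). f_equal.
  - apply (is_RInt_unique (V := R_CompleteNormedModule)), is_CInt_fst, H.
  - apply (is_RInt_unique (V := R_CompleteNormedModule)), is_CInt_snd, H.
Qed.

Lemma is_CInt_unique : forall (f : R -> C) a b (v w : C),
  is_CInt f a b v -> is_CInt f a b w -> v = w.
Proof.
  intros f a b v w H1 H2.
  rewrite <- (CInt_components _ _ _ _ H1). apply CInt_components, H2.
Qed.

Lemma ex_CInt_components : forall (f : R -> C) a b,
  ex_RInt (fun x => fst (f x)) a b -> ex_RInt (fun x => snd (f x)) a b ->
  exists v, is_CInt f a b v.
Proof.
  intros f a b [v1 H1] [v2 H2]. exists (v1, v2). apply is_CInt_pair; auto.
Qed.

Lemma ex_CInt_continuous : forall (f : R -> C) a b, a <= b ->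
  (forall x, a <= x <= b -> @continuous R_UniformSpace C_UniformSpace f x) ->
  exists v, is_CInt f a b v.
Proof.
  intros f a b Hab Hf. apply ex_CInt_components;
    apply (ex_RInt_continuous (V := R_CompleteNormedModule));
    intros x Hx; rewrite Rmin_left, Rmax_right in Hx by lra.
  - apply continuous_Cfst, Hf, Hx.
  - apply continuous_Csnd, Hf, Hx.
Qed.

Lemma is_CInt_split : forall (f : R -> C) a b c (v : C), a <= b <= c ->
  is_CInt f a c v ->
  exists v1 v2, is_CInt f a b v1 /\ is_CInt f b c v2 /\ (v1 + v2)%C = v.
Proof.
  intros f a b c v Hb H.
  assert (E1 : ex_RInt (fun x => fst (f x)) a c)
    by (eexists; apply is_CInt_fst, H).
  assert (E2 : ex_RInt (fun x => snd (f x)) a c)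
    by (eexists; apply is_CInt_snd, H).
  destruct (ex_CInt_components f a b) as [v1 H1].
  { apply (ex_RInt_Chasles_1 (V := R_CompleteNormedModule) _ a b c Hb E1). }
  { apply (ex_RInt_Chasles_1 (V := R_CompleteNormedModule) _ a b c Hb E2). }
  destruct (ex_CInt_components f b c) as [v2 H2].
  { apply (ex_RInt_Chasles_2 (V := R_CompleteNormedModule) _ a b c Hb E1). }
  { apply (ex_RInt_Chasles_2 (V := R_CompleteNormedModule) _ a b c Hb E2). }
  exists v1, v2. split; [exact H1|]. split; [exact H2|].
  apply (is_CInt_unique f a c); auto.
  exact (is_RInt_Chasles _ _ _ _ _ _ H1 H2).
Qed.

Lemma is_CInt_join : forall (f : R -> C) a b c (v w : C),
  is_CInt f a b v -> is_CInt f b c w -> is_CInt f a c (v + w)%C.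
Proof. intros f a b c v w H1 H2. exact (is_RInt_Chasles _ _ _ _ _ _ H1 H2). Qed.

Lemma is_CInt_ext : forall (f g : R -> C) a b (v : C), a <= b ->
  (forall x, a < x < b -> f x = g x) -> is_CInt f a b v -> is_CInt g a b v.
Proof.
  intros f g a b v Hab H. apply is_RInt_ext. intros x Hx.
  rewrite Rmin_left, Rmax_right in Hx by lra. apply H, Hx.
Qed.

Lemma is_CInt_plus : forall (f g : R -> C) a b (v w : C),
  is_CInt f a b v -> is_CInt g a b w ->
  is_CInt (fun x => (f x + g x)%C) a b (v + w)%C.
Proof. intros f g a b v w H1 H2. exact (is_RInt_plus _ _ _ _ _ _ H1 H2). Qed.

Lemma is_CInt_minus : forall (f g : R -> C) a b (v w : C),
  is_CInt f a b v -> is_CInt g a b w ->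
  is_CInt (fun x => (f x - g x)%C) a b (v - w)%C.
Proof. intros f g a b v w H1 H2. exact (is_RInt_minus _ _ _ _ _ _ H1 H2). Qed.

Lemma is_CInt_scal : forall (k : C) (f : R -> C) a b (v : C),
  is_CInt f a b v -> is_CInt (fun x => (k * f x)%C) a b (k * v)%C.
Proof.
  intros k f a b v H.
  assert (H1 := is_CInt_fst _ _ _ _ H). assert (H2 := is_CInt_snd _ _ _ _ H).
  apply is_CInt_pair; simpl.
  - apply @is_RInt_minus; apply @is_RInt_scal; auto.
  - apply @is_RInt_plus; apply @is_RInt_scal; auto.
Qed.

Lemma is_RInt_zero : forall a b, is_RInt (fun _ => 0) a b 0.
Proof.
  intros a b. generalize (@is_RInt_const R_NormedModule a b 0).
  rewrite (@scal_zero_r R_AbsRing R_NormedModule). auto.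
Qed.

Lemma is_CInt_real : forall (f : R -> R) a b v,
  is_RInt f a b v -> is_CInt (fun x => RtoC (f x)) a b (RtoC v).
Proof.
  intros f a b v H. apply is_CInt_pair; simpl; auto. apply is_RInt_zero.
Qed.

Lemma is_CInt_zero : forall a b, is_CInt (fun _ => 0%C) a b 0%C.
Proof.
  intros a b. apply (is_CInt_real (fun _ => 0)). apply is_RInt_zero.
Qed.

Lemma is_CInt_shift : forall (f : R -> C) c a b (v : C),
  is_CInt f (a + c) (b + c) v -> is_CInt (fun x => f (x + c)) a b v.
Proof.
  intros f c a b v H.
  assert (H' : is_CInt (fun x => @scal R_AbsRing C_R_NormedModule 1 (f (1 * x + c))) a b v).
  { apply is_RInt_comp_lin. rewrite !Rmult_1_l. exact H. }
  revert H'. apply is_RInt_ext. intros x _.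
  rewrite Rmult_1_l. apply (@scal_one R_AbsRing C_R_NormedModule).
Qed.

Lemma is_CInt_bound : forall (f : R -> C) (g : R -> R) a b (v : C) w, a <= b ->
  (forall x, a <= x <= b -> Cmod (f x) <= g x) ->
  is_CInt f a b v -> is_RInt g a b w -> Cmod v <= w.
Proof.
  intros f g a b v w Hab Hfg Hv Hw. rewrite <- norm_C_R.
  apply (norm_RInt_le f g a b v w); auto.
  intros x Hx. rewrite norm_C_R. apply Hfg, Hx.
Qed.

Lemma is_CInt_bound_const : forall (f : R -> C) a b (v : C) M, a <= b ->
  (forall x, a <= x <= b -> Cmod (f x) <= M) ->
  is_CInt f a b v -> Cmod v <= (b - a) * M.
Proof.
  intros f a b v M Hab Hf Hv. rewrite <- norm_C_R.
  apply (norm_RInt_le_const f a b v M); auto.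
  intros x Hx. rewrite norm_C_R. apply Hf, Hx.
Qed.

Lemma is_RInt_derive_R : forall (f df : R -> R) a b, a <= b ->
  (forall x, a <= x <= b -> is_derive f x (df x)) ->
  (forall x, a <= x <= b -> continuous df x) ->
  is_RInt df a b (f b - f a).
Proof.
  intros f df a b Hab H1 H2.
  apply (is_RInt_derive (V := R_CompleteNormedModule) f df);
    intros x Hx; rewrite Rmin_left, Rmax_right in Hx by lra; auto.
Qed.

(** * Pointwise estimates for the kernels *)

Lemma Ci_sqr : (Ci * Ci)%C = (- 1)%C.
Proof. apply injective_projections; simpl; ring. Qed.

Lemma Cmod_RCi : forall x y : R, Cmod (x + y * Ci)%C = sqrt (x * x + y * y).
Proof. intros x y. unfold Cmod. f_equal. simpl. ring. Qed.

Lemma pole_factor_lower : forall (w : C) (x h eta : R),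
  eta <= 1 / 2 -> Cmod (w - x)%C <= eta * Rabs x ->
  1 / 2 * sqrt (x * x + h * h) <= Cmod (w + h * Ci)%C.
Proof.
  intros w x h eta He Hw.
  assert (H1 := Cmod_triangle_sub (x + h * Ci)%C (x - w)%C).
  replace (x + h * Ci - (x - w))%C with (w + h * Ci)%C in H1 by ring.
  rewrite Cmod_RCi, (Cmod_sub_sym x w) in H1.
  assert (H2 : Rabs x <= sqrt (x * x + h * h)).
  { rewrite <- sqrt_Rsqr_abs. apply sqrt_le_1_alt. unfold Rsqr. nra. }
  assert (H3 := Rabs_pos x). nra.
Qed.

(** Throughout, [w] stands for a function with a simple zero at [0] and
    derivative [1] there, evaluated at [x]: it equals [x] up to the relative
    error [eta]. The density [p] equals [p0] up to [eta]. Every kernel in [w]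
    is compared with the same kernel in [x], and the errors are all measured
    against the Poisson kernel [h / (x * x + h * h)], whose integral stays
    bounded as [h] tends to [0]. *)
Section Near.
Variables (w p p0 : C) (x h eta : R).
Hypothesis Hh : 0 < h.
Hypothesis He0 : 0 <= eta.
Hypothesis He : eta <= 1 / 2.
Hypothesis Hw : Cmod (w - x)%C <= eta * Rabs x.
Hypothesis Hp : Cmod (p - p0)%C <= eta.

Let D := x * x + h * h.

Lemma near_D_pos : 0 < D.
Proof. unfold D. nra. Qed.

Lemma near_plus_neq0 : (w + h * Ci)%C <> 0%C.
Proof.
  apply Cmod_gt_0.
  eapply Rlt_le_trans; [|apply (pole_factor_lower w x h eta); auto].
  generalize (sqrt_lt_R0 _ near_D_pos). unfold D. lra.
Qed.

Lemma near_minus_neq0 : (w - h * Ci)%C <> 0%C.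
Proof.
  replace (w - h * Ci)%C with (w + (- h)%R * Ci)%C
    by (rewrite RtoC_opp; ring).
  apply Cmod_gt_0.
  eapply Rlt_le_trans; [|apply (pole_factor_lower w x (- h) eta); auto].
  replace (x * x + - h * - h) with D by (unfold D; ring).
  generalize (sqrt_lt_R0 _ near_D_pos). lra.
Qed.

Lemma near_factor : (w * w + h * h)%C = ((w - h * Ci) * (w + h * Ci))%C.
Proof.
  replace ((w - h * Ci) * (w + h * Ci))%C
    with (w * w - h * h * (Ci * Ci))%C by ring.
  rewrite Ci_sqr. ring.
Qed.

Lemma near_lower : D / 4 <= Cmod (w * w + h * h)%C.
Proof.
  rewrite near_factor, Cmod_mult.
  assert (H1 := pole_factor_lower w x h eta He Hw).
  assert (H2 := pole_factor_lower w x (- h) eta He Hw).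
  replace (w + (- h)%R * Ci)%C with (w - h * Ci)%C in H2
    by (rewrite RtoC_opp; ring).
  replace (x * x + - h * - h) with D in H2 by (unfold D; ring).
  fold D in H1.
  assert (H3 := sqrt_lt_R0 _ near_D_pos).
  assert (H4 := sqrt_sqrt D (Rlt_le _ _ near_D_pos)).
  nra.
Qed.

Lemma near_neq0 : (w * w + h * h)%C <> 0%C.
Proof.
  apply Cmod_gt_0. generalize near_lower near_D_pos. lra.
Qed.

Lemma near_upper : Cmod w <= 3 / 2 * Rabs x.
Proof.
  replace w with ((w - x) + x)%C by ring.
  generalize (Cmod_triangle (w - x)%C x). rewrite Cmod_R.
  generalize (Rabs_pos x). nra.
Qed.

Lemma near_lower_w : Rabs x / 2 <= Cmod w.
Proof.
  generalize (Cmod_triangle_sub x (x - w)%C). rewrite Cmod_R.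
  replace (x - (x - w))%C with w by ring. rewrite (Cmod_sub_sym x w).
  generalize (Rabs_pos x). nra.
Qed.

Lemma near_D_C : (RtoC x * x + h * h)%C = RtoC D.
Proof. unfold D. rewrite RtoC_plus, !RtoC_mult. reflexivity. Qed.

Lemma near_D_C_neq0 : RtoC D <> 0%C.
Proof.
  intros H. apply RtoC_inj in H. generalize near_D_pos. lra.
Qed.

(** The difference of the two kernels is [2 * h * Ci / (w * w + h * h)]. *)
Lemma near_jump :
  Cmod (p * (/ (w - h * Ci) - / (w + h * Ci)) - p0 * (2 * (h / D) * Ci))%C
  <= (8 + 24 * Cmod p0) * eta * (h / D).
Proof.
  assert (HD := near_D_pos). assert (Hl := near_lower).
  assert (Hn := near_neq0). assert (HDC := near_D_C_neq0).
  assert (N1 := near_plus_neq0). assert (N2 := near_minus_neq0).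
  assert (E : (p * (/ (w - h * Ci) - / (w + h * Ci))
               - p0 * (2 * (h / D) * Ci))%C =
    (2 * h * Ci * (((p - p0) * D + p0 * ((x - w) * (x + w))) /
       ((w * w + h * h) * D)))%C).
  { replace (/ (w - h * Ci) - / (w + h * Ci))%C
      with (2 * h * Ci / (w * w + h * h))%C
      by (rewrite near_factor; field; auto).
    replace ((x - w) * (x + w))%C with (D - (w * w + h * h))%C
      by (rewrite <- near_D_C; ring).
    field; auto. }
  rewrite E. clear E.
  rewrite !Cmod_mult, Cmod_Ci, Cmod_div, Cmod_mult, !Cmod_R
    by (apply Cmult_neq_0; auto).
  rewrite (Rabs_right 2), (Rabs_right h), (Rabs_right D) by lra.
  assert (Hnum : Cmod ((p - p0) * D + p0 * ((x - w) * (x + w)))%C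
                 <= (1 + 3 * Cmod p0) * eta * D).
  { eapply Rle_trans; [apply Cmod_triangle|].
    rewrite !Cmod_mult, Cmod_R, (Rabs_right D) by lra.
    rewrite (Cmod_sub_sym x w).
    assert (A : Cmod (x + w)%C <= 5 / 2 * Rabs x).
    { generalize (Cmod_triangle x w) near_upper. rewrite Cmod_R. lra. }
    assert (A2 : Rabs x * Rabs x <= D).
    { rewrite <- Rabs_mult, Rabs_right; unfold D; nra. }
    assert (A3 := Rabs_pos x). assert (A4 := Cmod_ge_0 p0).
    assert (A5 := Cmod_ge_0 (x + w)%C). assert (A6 := Cmod_ge_0 (w - x)%C).
    assert (B : Cmod (w - x)%C * Cmod (x + w)%C <= 3 * eta * D).
    { apply Rle_trans with ((eta * Rabs x) * (5 / 2 * Rabs x)).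
      - apply Rmult_le_compat; auto.
      - nra. }
    assert (B2 : Cmod (p - p0)%C * D <= eta * D)
      by (apply Rmult_le_compat_r; lra).
    assert (B3 := Rmult_le_compat_l _ _ _ A4 B). nra. }
  apply Rle_trans with (2 * h * 1 * ((1 + 3 * Cmod p0) * eta * D / (D / 4 * D))).
  - apply Rmult_le_compat_l; [lra|].
    unfold Rdiv at 1 2. apply Rmult_le_compat; auto.
    + apply Cmod_ge_0.
    + left. apply Rinv_0_lt_compat. apply Rmult_lt_0_compat; lra.
    + apply Rinv_le_contravar; [nra|]. apply Rmult_le_compat_r; lra.
  - right. field. lra.
Qed.

(** The sum of the two kernels is [2 * w / (w * w + h * h)]. For [h <= |w|]
    subtracting [2 / w] cancels its slow decay and leaves a term of order
    [h ^ 2 / |x| ^ 3]; for [|w| < h] the sum itself is of order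
    [|x| / h ^ 2]. Both are bounded by a multiple of the Poisson kernel, and
    the factor [eta] comes from comparing [w] with [x]. The truncation of the
    model kernel is decided by [w], so that both kernels are truncated at the
    same [x]. *)
Lemma near_symmetric :
  Cmod (p * (/ (w - h * Ci) + / (w + h * Ci)
             - 2 * (if Rle_dec h (Cmod w) then / w else 0))
        - p0 * (2 * (x / D) - 2 * (if Rle_dec h (Cmod w) then / x else 0)))%C
  <= (24 + 120 * Cmod p0) * eta * (h / D).
Proof.
  assert (HD := near_D_pos). assert (Hl := near_lower).
  assert (Hn := near_neq0). assert (HDC := near_D_C_neq0).
  assert (N1 := near_plus_neq0). assert (N2 := near_minus_neq0).
  assert (Hup := near_upper). assert (Hlo := near_lower_w).
  assert (A3 := Rabs_pos x). assert (A4 := Cmod_ge_0 p0).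
  assert (A6 := Cmod_ge_0 (w - x)%C).
  assert (A2 : Rabs x * Rabs x = x * x)
    by (rewrite <- Rabs_mult, Rabs_right; nra).
  replace (/ (w - h * Ci) + / (w + h * Ci))%C
    with (2 * w / (w * w + h * h))%C by (rewrite near_factor; field; auto).
  destruct (Rle_dec h (Cmod w)) as [Hc|Hc].
  - (* The two kernels left here are [-2 h^2 / (w (w^2 + h^2))] and its
       analogue in [x]. *)
    assert (Hx : 0 < Rabs x) by lra.
    assert (Hx0 : RtoC x <> 0%C).
    { intros H. apply RtoC_inj in H. rewrite H, Rabs_R0 in Hx. lra. }
    assert (Hw0 : w <> 0%C) by (apply Cmod_gt_0; lra).
    assert (E : (p * (2 * w / (w * w + h * h) - 2 * / w)
                 - p0 * (2 * (x / D) - 2 * / x))%C =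
      (-2 * (h * h) * (((p - p0) * (x * D)
           + p0 * ((x - w) * (x * x + x * w + w * w + h * h))) /
         ((w * (w * w + h * h)) * (x * D))))%C).
    { replace ((x - w) * (x * x + x * w + w * w + h * h))%C
        with (x * (x * x + h * h) - w * (w * w + h * h))%C by ring.
      transitivity (-2 * (h * h) * (p / (w * (w * w + h * h)) - p0 / (x * D)))%C.
      { rewrite <- near_D_C. rewrite <- near_D_C in HDC. field; auto. }
      rewrite near_D_C. field; auto. }
    rewrite E. clear E.
    rewrite !Cmod_mult, Cmod_div, !Cmod_mult, !Cmod_R
      by (repeat apply Cmult_neq_0; auto).
    replace (Rabs (-2)) with 2 by (rewrite Rabs_left; lra).
    rewrite (Rabs_right h), (Rabs_right D) by lra.
    assert (Hnum : Cmod ((p - p0) * (x * D)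
           + p0 * ((x - w) * (x * x + x * w + w * w + h * h)))%C
                   <= (1 + 5 * Cmod p0) * eta * (Rabs x * D)).
    { eapply Rle_trans; [apply Cmod_triangle|].
      rewrite !Cmod_mult, !Cmod_R, (Rabs_right D) by lra.
      rewrite (Cmod_sub_sym x w).
      assert (A : Cmod (x * x + x * w + w * w + h * h)%C <= 5 * D).
      { eapply Rle_trans; [apply Cmod_triangle|].
        eapply Rle_trans;
          [apply Rplus_le_compat_r; eapply Rle_trans;
           [apply Cmod_triangle
           |apply Rplus_le_compat_r; apply Cmod_triangle]|].
        rewrite !Cmod_mult, !Cmod_R, (Rabs_right h) by lra.
        assert (Cmod w * Cmod w <= 3 / 2 * Rabs x * (3 / 2 * Rabs x))
          by (apply Rmult_le_compat; auto; apply Cmod_ge_0).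
        assert (Rabs x * Cmod w <= Rabs x * (3 / 2 * Rabs x))
          by (apply Rmult_le_compat_l; auto).
        unfold D. nra. }
      assert (B : Cmod (w - x)%C * Cmod (x * x + x * w + w * w + h * h)%C
                  <= (eta * Rabs x) * (5 * D)).
      { apply Rmult_le_compat; auto. apply Cmod_ge_0. }
      assert (B2 : Cmod (p - p0)%C * (Rabs x * D) <= eta * (Rabs x * D))
        by (apply Rmult_le_compat_r; nra).
      assert (B3 := Rmult_le_compat_l _ _ _ A4 B). nra. }
    apply Rle_trans with (2 * (h * h) *
       ((1 + 5 * Cmod p0) * eta * (Rabs x * D)
         / (Rabs x / 2 * (D / 4) * (Rabs x * D)))).
    + apply Rmult_le_compat_l; [nra|].
      assert (0 < Rabs x * D) by (apply Rmult_lt_0_compat; lra).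
      assert (0 < Rabs x / 2 * (D / 4)) by (apply Rmult_lt_0_compat; lra).
      assert (Rabs x / 2 * (D / 4) <= Cmod w * Cmod (w * w + h * h)%C)
        by (apply Rmult_le_compat; lra).
      unfold Rdiv at 1 2. apply Rmult_le_compat; auto.
      * apply Cmod_ge_0.
      * left. apply Rinv_0_lt_compat. apply Rmult_lt_0_compat; lra.
      * apply Rinv_le_contravar; [apply Rmult_lt_0_compat; lra|].
        apply Rmult_le_compat_r; lra.
    + apply Rle_trans with
        ((16 + 80 * Cmod p0) * eta * (h / D) * (h / Rabs x)).
      { right. field. lra. }
      assert (Hq : h / Rabs x <= 3 / 2).
      { apply (Rmult_le_reg_r (Rabs x)); auto. unfold Rdiv at 1.
        rewrite Rmult_assoc, Rinv_l; lra. }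
      assert (0 <= (16 + 80 * Cmod p0) * eta * (h / D)).
      { assert (0 < h / D) by (apply Rdiv_lt_0_compat; lra).
        apply Rmult_le_pos; [apply Rmult_le_pos|]; lra. }
      apply Rle_trans with
        ((16 + 80 * Cmod p0) * eta * (h / D) * (3 / 2)).
      * apply Rmult_le_compat_l; auto.
      * right. field. lra.
  - assert (Hx : Rabs x <= 2 * h) by lra.
    assert (E : (p * (2 * w / (w * w + h * h) - 2 * 0)
                 - p0 * (2 * (x / D) - 2 * 0))%C =
      (2 * (((p - p0) * (w * D)
           + p0 * ((w - x) * (h * h - w * x))) /
         ((w * w + h * h) * D)))%C).
    { replace ((w - x) * (h * h - w * x))%C
        with (w * (x * x + h * h) - x * (w * w + h * h))%C by ring.
      rewrite near_D_C. field; auto. }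
    rewrite E. clear E.
    rewrite !Cmod_mult, Cmod_div, !Cmod_mult, !Cmod_R
      by (repeat apply Cmult_neq_0; auto).
    rewrite (Rabs_right 2), (Rabs_right D) by lra.
    assert (Hnum : Cmod ((p - p0) * (w * D)
           + p0 * ((w - x) * (h * h - w * x)))%C
                   <= 3 / 2 * (1 + Cmod p0) * eta * (Rabs x * D)).
    { eapply Rle_trans; [apply Cmod_triangle|].
      rewrite !Cmod_mult, !Cmod_R, (Rabs_right D) by lra.
      assert (A : Cmod (h * h - w * x)%C <= 3 / 2 * D).
      { eapply Rle_trans; [apply Cmod_sub_le|].
        rewrite !Cmod_mult, !Cmod_R, (Rabs_right h) by lra.
        assert (Cmod w * Rabs x <= 3 / 2 * Rabs x * Rabs x)
          by (apply Rmult_le_compat_r; auto).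
        unfold D. nra. }
      assert (B : Cmod (w - x)%C * Cmod (h * h - w * x)%C
                  <= (eta * Rabs x) * (3 / 2 * D)).
      { apply Rmult_le_compat; auto. apply Cmod_ge_0. }
      assert (B2 : Cmod (p - p0)%C * (Cmod w * D)
                   <= eta * (3 / 2 * Rabs x * D)).
      { apply Rmult_le_compat; auto.
        - apply Cmod_ge_0.
        - apply Rmult_le_pos; [apply Cmod_ge_0|lra].
        - apply Rmult_le_compat_r; lra. }
      assert (B3 := Rmult_le_compat_l _ _ _ A4 B). nra. }
    apply Rle_trans with
      (2 * (3 / 2 * (1 + Cmod p0) * eta * (2 * h * D) / (D / 4 * D))).
    + apply Rmult_le_compat_l; [lra|].
      unfold Rdiv at 1 3. apply Rmult_le_compat; auto.
      * apply Cmod_ge_0.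
      * left. apply Rinv_0_lt_compat. apply Rmult_lt_0_compat; lra.
      * eapply Rle_trans; [exact Hnum|]. apply Rmult_le_compat_l; [nra|].
        apply Rmult_le_compat_r; lra.
      * apply Rinv_le_contravar; [nra|]. apply Rmult_le_compat_r; lra.
    + apply Rle_trans with ((24 + 24 * Cmod p0) * eta * (h / D)).
      * right. field. lra.
      * assert (0 < h / D) by (apply Rdiv_lt_0_compat; lra).
        apply Rmult_le_compat_r; [lra|]. apply Rmult_le_compat_r; lra.
Qed.

End Near.

Lemma far_lower : forall (w : C) (h m : R),
  0 < h -> h <= m / 2 -> m <= Cmod w ->
  (w - h * Ci)%C <> 0%C /\ (w + h * Ci)%C <> 0%C /\
  m * m / 2 <= Cmod (w * w + h * h)%C.
Proof.
  intros w h m Hh Hm Hw.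
  assert (Hhc : Cmod (h * Ci)%C = h)
    by (rewrite Cmod_mult, Cmod_Ci, Cmod_R, Rabs_right; lra).
  assert (H1 := Cmod_triangle_sub w (h * Ci)%C).
  assert (H2 := Cmod_triangle_sub w (- (h * Ci))%C).
  rewrite Cmod_opp in H2.
  replace (w - - (h * Ci))%C with (w + h * Ci)%C in H2 by ring.
  repeat split.
  - apply Cmod_gt_0. lra.
  - apply Cmod_gt_0. lra.
  - assert (H3 := Cmod_triangle_sub (w * w)%C (- (h * h))%C).
    replace (w * w - - (h * h))%C with (w * w + h * h)%C in H3 by ring.
    rewrite Cmod_opp, !Cmod_mult, !Cmod_R, (Rabs_right h) in H3 by lra.
    assert (m * m <= Cmod w * Cmod w) by (apply Rmult_le_compat; lra).
    nra.
Qed.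

Lemma far_jump : forall (w p : C) (h m B : R),
  0 < h -> h <= m / 2 -> m <= Cmod w -> Cmod p <= B ->
  Cmod (p * (/ (w - h * Ci) - / (w + h * Ci)))%C <= 4 * B / (m * m) * h.
Proof.
  intros w p h m B Hh Hm Hw Hp.
  destruct (far_lower w h m Hh Hm Hw) as [N1 [N2 Hl]].
  assert (Hmm : 0 < m * m) by nra.
  assert (Hn : (w * w + h * h)%C <> 0%C) by (apply Cmod_gt_0; lra).
  replace (p * (/ (w - h * Ci) - / (w + h * Ci)))%C
    with (p * (2 * h * Ci) / (w * w + h * h))%C.
  2:{ rewrite near_factor. field; auto. }
  rewrite Cmod_div, !Cmod_mult, Cmod_Ci, !Cmod_R by auto.
  rewrite (Rabs_right 2), (Rabs_right h) by lra.
  apply Rle_trans with (B * (2 * h * 1) / (m * m / 2)).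
  - unfold Rdiv at 1 2. apply Rmult_le_compat.
    + assert (Hc := Cmod_ge_0 p). nra.
    + left. apply Rinv_0_lt_compat. lra.
    + apply Rmult_le_compat_r; lra.
    + apply Rinv_le_contravar; lra.
  - right. field. nra.
Qed.

(** The bound is of second order in [h]; one factor [h / |w| <= 1] is given
    away to have the same bound as for the difference. *)
Lemma far_symmetric : forall (w p : C) (h m B : R),
  0 < h -> h <= m / 2 -> m <= Cmod w -> Cmod p <= B ->
  Cmod (p * (/ (w - h * Ci) + / (w + h * Ci) - 2 * / w))%C
    <= 4 * B / (m * m) * h.
Proof.
  intros w p h m B Hh Hm Hw Hp.
  destruct (far_lower w h m Hh Hm Hw) as [N1 [N2 Hl]].
  assert (Hmm : 0 < m * m) by nra.
  assert (Hn : (w * w + h * h)%C <> 0%C) by (apply Cmod_gt_0; lra).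
  assert (Hw0 : w <> 0%C) by (apply Cmod_gt_0; lra).
  replace (p * (/ (w - h * Ci) + / (w + h * Ci) - 2 * / w))%C
    with (p * (-2 * (h * (h / w))) / (w * w + h * h))%C.
  2:{ transitivity (p * (2 * w / (w * w + h * h) - 2 * / w))%C.
      - field; auto.
      - rewrite near_factor. field; auto. }
  rewrite Cmod_div, !Cmod_mult, Cmod_div, !Cmod_R by auto.
  replace (Rabs (-2)) with 2 by (rewrite Rabs_left; lra).
  rewrite (Rabs_right h) by lra.
  assert (Hq : h / Cmod w <= 1).
  { apply (Rmult_le_reg_r (Cmod w)); [lra|]. unfold Rdiv.
    rewrite Rmult_assoc, Rinv_l; lra. }
  assert (Hq0 : 0 <= h / Cmod w) by (apply Rdiv_le_0_compat; lra).
  apply Rle_trans with (B * (2 * (h * 1)) / (m * m / 2)).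
  - unfold Rdiv at 1 3. apply Rmult_le_compat.
    + assert (Hc := Cmod_ge_0 p). apply Rmult_le_pos; nra.
    + left. apply Rinv_0_lt_compat. lra.
    + assert (Hc := Cmod_ge_0 p). apply Rmult_le_compat; auto; nra.
    + apply Rinv_le_contravar; lra.
  - right. field. nra.
Qed.

(** * The kernels near a simple zero *)

Lemma ln_le_sub1 : forall x, 0 < x -> ln x <= x - 1.
Proof.
  intros x Hx. generalize (exp_ineq1_le (ln x)). rewrite exp_ln; lra.
Qed.

Lemma atan_le_id : forall x, 0 <= x -> atan x <= x.
Proof.
  intros x Hx. destruct (Req_dec x 0) as [->|H]; [rewrite atan_0; lra|].
  destruct (MVT_gen atan 0 x (fun t => / (1 + Rsqr t))) as [c [_ Hc]].
  - intros t _. apply is_derive_atan.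
  - intros t _. apply derivable_continuous_pt, derivable_pt_atan.
  - rewrite atan_0, !Rminus_0_r in Hc. rewrite Hc.
    rewrite <- (Rmult_1_l x) at 2. apply Rmult_le_compat_r; auto.
    rewrite <- Rinv_1. apply Rinv_le_contravar; [lra|].
    generalize (Rle_0_sqr c). lra.
Qed.

Lemma poisson_integral : forall h d, 0 < h -> 0 <= d ->
  is_RInt (fun x => h / (x * x + h * h)) (- d) d (2 * atan (d / h)).
Proof.
  intros h d Hh Hd.
  replace (2 * atan (d / h)) with (atan (d / h) - atan (- d / h)).
  2:{ replace (- d / h) with (- (d / h)) by (field; lra).
      rewrite atan_opp. ring. }
  apply (is_RInt_derive_R (fun x => atan (x / h))); [lra| |].
  - intros x _.
    replace (h / (x * x + h * h)) with (scal (/ h) (/ (1 + Rsqr (x / h)))).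
    + apply (is_derive_comp atan (fun y => y / h)).
      * apply is_derive_atan.
      * auto_derive; [auto|]. field. lra.
    + unfold scal; simpl; unfold mult; simpl. unfold Rsqr. field.
      split; nra.
  - intros x _. apply (ex_derive_continuous (V := R_NormedModule)).
    auto_derive. nra.
Qed.

Lemma poisson_integral_le_PI : forall h d, 2 * atan (d / h) <= PI.
Proof. intros h d. generalize (atan_bound (d / h)). lra. Qed.

Lemma poisson_integral_to_PI : forall h d, 0 < h -> 0 < d ->
  PI - 2 * (h / d) <= 2 * atan (d / h).
Proof.
  intros h d Hh Hd.
  assert (H0 : 0 < h / d) by (apply Rdiv_lt_0_compat; lra).
  assert (H1 := atan_inv (h / d) H0).
  replace (/ (h / d)) with (d / h) in H1 by (field; lra).
  generalize (atan_le_id (h / d) (Rlt_le _ _ H0)). lra.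
Qed.

(** A kernel that is small away from [0] and within a Poisson kernel of a
    model near [0] has nearly the integral of the model. *)
Lemma concentrated_integral : forall (G M : R -> C) (V W : C) Q d h K A,
  0 < h -> 0 <= d <= Q -> 0 <= K ->
  is_CInt G (- Q) Q V -> is_CInt M (- d) d W ->
  (forall x, - d <= x <= d ->
     Cmod (G x - M x)%C <= K * (h / (x * x + h * h))) ->
  (forall x, - Q <= x <= Q -> d <= Rabs x -> Cmod (G x) <= A) ->
  Cmod (V - W)%C <= K * PI + 2 * Q * A.
Proof.
  intros G M V W Q d h K A Hh Hd HK HV HW Hnear Hfar.
  destruct (is_CInt_split G (- Q) (- d) Q V) as [V1 [V' [H1 [H' E1]]]];
    [lra|auto|].
  destruct (is_CInt_split G (- d) d Q V') as [V2 [V3 [H2 [H3 E2]]]];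
    [lra|auto|].
  assert (B1 : Cmod V1 <= (- d - - Q) * A).
  { apply (is_CInt_bound_const G); auto; [lra|]. intros x Hx.
    apply Hfar; [lra|]. rewrite Rabs_left1; lra. }
  assert (B3 : Cmod V3 <= (Q - d) * A).
  { apply (is_CInt_bound_const G); auto; [lra|]. intros x Hx.
    apply Hfar; [lra|]. rewrite Rabs_right; lra. }
  assert (B2 : Cmod (V2 - W)%C <= K * (2 * atan (d / h))).
  { apply (is_CInt_bound (fun x => (G x - M x)%C)
      (fun x => K * (h / (x * x + h * h))) (- d) d); auto; [lra| |].
    - apply is_CInt_minus; auto.
    - apply (is_RInt_scal (V := R_NormedModule)
        (fun x => h / (x * x + h * h))). apply poisson_integral; lra. }
  assert (B4 := poisson_integral_le_PI h d).
  assert (B5 : K * (2 * atan (d / h)) <= K * PI)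
    by (apply Rmult_le_compat_l; auto).
  assert (HA : 0 <= A).
  { eapply Rle_trans; [apply (Cmod_ge_0 (G Q))|]. apply Hfar; [lra|].
    rewrite Rabs_right; lra. }
  subst V V'.
  replace (V1 + (V2 + V3) - W)%C with (V1 + ((V2 - W) + V3))%C by ring.
  eapply Rle_trans; [apply Cmod_triangle|].
  generalize (Cmod_triangle (V2 - W)%C V3). nra.
Qed.

Lemma small_multiple : forall K e, 0 < e ->
  exists h0, 0 < h0 /\ forall h, 0 < h < h0 -> K * h <= e.
Proof.
  intros K e He. exists (e / (Rabs K + 1)).
  assert (HK := Rabs_pos K). split.
  - apply Rdiv_lt_0_compat; lra.
  - intros h [H1 H2].
    apply (Rmult_lt_compat_r (Rabs K + 1)) in H2; [|lra].
    unfold Rdiv in H2. rewrite Rmult_assoc, Rinv_l, Rmult_1_r in H2 by lra.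
    generalize (Rle_abs K). nra.
Qed.

Section SimpleZero.
Variables (u p : R -> C) (p0 : C) (Q : R).
Hypothesis HQ : 0 < Q.
Hypothesis Hcu : forall x, @continuous R_UniformSpace C_UniformSpace u x.
Hypothesis Hcp : forall x, @continuous R_UniformSpace C_UniformSpace p x.
Hypothesis Hloc : forall eta, 0 < eta -> exists d, 0 < d /\
  forall x, Rabs x <= d ->
    Cmod (u x - x)%C <= eta * Rabs x /\ Cmod (p x - p0)%C <= eta.
Hypothesis Hfar : forall d, 0 < d -> exists m, 0 < m /\
  forall x, - Q <= x <= Q -> d <= Rabs x -> m <= Cmod (u x).

Lemma symmetric_points_off : exists h0, 0 < h0 /\ forall h, 0 < h < h0 ->
  forall x, - Q <= x <= Q ->
    (u x - h * Ci)%C <> 0%C /\ (u x + h * Ci)%C <> 0%C.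
Proof.
  destruct (Hloc (1 / 2)) as [d [Hd Hl]]; [lra|].
  destruct (Hfar d Hd) as [m [Hm Hf]].
  exists (m / 2). split; [lra|]. intros h Hh x Hx.
  destruct (Rle_dec (Rabs x) d) as [Hxd|Hxd].
  - destruct (Hl x Hxd) as [H1 _]. split.
    + apply (near_minus_neq0 _ x h (1 / 2)); auto; lra.
    + apply (near_plus_neq0 _ x h (1 / 2)); auto; lra.
  - destruct (far_lower (u x) h m) as [H1 [H2 _]]; auto; try lra.
    apply Hf; auto. lra.
Qed.

(** Choice of the relative error [eta], of the radius [d] of the near zone and
    of the bounds valid beyond it. In the total error,
    [(24 + 120 * Cmod p0) * PI] dominates the constants of both pointwise
    estimates times the mass of the Poisson kernel, and [8 * Cmod p0] pays for
    the asymmetry of the truncated interval. *)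
Lemma near_radius : forall e, 0 < e -> exists eta d m B,
  0 < eta <= 1 / 2 /\ 0 < d <= Q /\ 0 < m /\ 0 < B /\
  eta * ((24 + 120 * Cmod p0) * PI + 8 * Cmod p0) <= e /\
  (forall x, Rabs x <= d ->
    Cmod (u x - x)%C <= eta * Rabs x /\ Cmod (p x - p0)%C <= eta) /\
  (forall x, - Q <= x <= Q -> d <= Rabs x -> m <= Cmod (u x)) /\
  (forall x, - Q <= x <= Q -> Cmod (p x) <= B).
Proof.
  intros e He.
  destruct (small_multiple ((24 + 120 * Cmod p0) * PI + 8 * Cmod p0) e He)
    as [e0 [He0 Hs]].
  set (eta := Rmin (1 / 2) (e0 / 2)).
  assert (A1 : eta <= 1 / 2) by apply Rmin_l.
  assert (A2 : eta <= e0 / 2) by apply Rmin_r.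
  assert (A3 : 0 < eta) by (apply Rmin_pos; lra).
  destruct (Hloc eta A3) as [d [Hd Hl]].
  set (d' := Rmin d Q).
  assert (B1 : d' <= d) by apply Rmin_l.
  assert (B2 : d' <= Q) by apply Rmin_r.
  assert (B3 : 0 < d') by (apply Rmin_pos; lra).
  destruct (Hfar d' B3) as [m [Hm Hf]].
  destruct (continuous_bounded p (- Q) Q) as [B [HB HBp]]; [auto|].
  exists eta, d', m, B. repeat split; auto.
  - rewrite Rmult_comm. apply Hs. lra.
  - apply Hl. lra.
  - apply Hl. lra.
Qed.

(** The two kernels differ by nearly [2 * Ci] times the Poisson kernel, an
    approximate identity of mass [2 * PI * Ci]. *)
Lemma jump_limit : forall e, 0 < e -> exists h0, 0 < h0 /\
  forall h V1 V2, 0 < h < h0 ->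
    is_CInt (fun x => (p x * / (u x - h * Ci))%C) (- Q) Q V1 ->
    is_CInt (fun x => (p x * / (u x + h * Ci))%C) (- Q) Q V2 ->
    Cmod (V1 - V2 - 2 * PI * Ci * p0)%C <= e.
Proof.
  intros e He.
  destruct (near_radius (e / 3)) as
    (eta & d & m & B & Heta & Hd & Hm & HB & Hbudget & Hl & Hf & Hp); [lra|].
  destruct (small_multiple (2 * Q * (4 * B / (m * m))) (e / 3))
    as [h1 [Hh1 Hs1]]; [lra|].
  destruct (small_multiple (4 / d * Cmod p0) (e / 3)) as [h2 [Hh2 Hs2]]; [lra|].
  exists (Rmin (m / 2) (Rmin h1 h2)).
  split; [repeat apply Rmin_pos; lra|].
  intros h V1 V2 [Hh Hlt] HV1 HV2.
  assert (L1 : h < m / 2) by (eapply Rlt_le_trans; [exact Hlt|apply Rmin_l]).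
  assert (L2 : h < Rmin h1 h2)
    by (eapply Rlt_le_trans; [exact Hlt|apply Rmin_r]).
  assert (L3 : h < h1) by (eapply Rlt_le_trans; [exact L2|apply Rmin_l]).
  assert (L4 : h < h2) by (eapply Rlt_le_trans; [exact L2|apply Rmin_r]).
  specialize (Hs1 h (conj Hh L3)). specialize (Hs2 h (conj Hh L4)).
  assert (HV := is_CInt_minus _ _ _ _ _ _ HV1 HV2).
  assert (HW : is_CInt
    (fun x => (p0 * (2 * (h / (x * x + h * h)%R) * Ci))%C) (- d) d
    (p0 * (2 * Ci) * (2 * atan (d / h))%R)%C).
  { apply is_CInt_ext with
      (fun x => (p0 * (2 * Ci) * RtoC (h / (x * x + h * h))%R)%C); [lra| |].
    - intros x _. rewrite RtoC_div by nra. ring.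
    - apply is_CInt_scal. apply is_CInt_real, poisson_integral; lra. }
  assert (Hp0 := Cmod_ge_0 p0).
  assert (HC : Cmod (V1 - V2 - p0 * (2 * Ci) * (2 * atan (d / h))%R)%C
     <= (24 + 120 * Cmod p0) * eta * PI + 2 * Q * (4 * B / (m * m) * h)).
  { apply (concentrated_integral _ _ _ _ Q d h
      ((24 + 120 * Cmod p0) * eta) (4 * B / (m * m) * h) Hh
      ltac:(lra) ltac:(nra) HV HW).
    - intros x Hx. destruct (Hl x) as [E1 E2]; [apply Rabs_le; lra|].
      assert (E := near_jump (u x) (p x) p0 x h eta Hh
        (Rlt_le _ _ (proj1 Heta)) (proj2 Heta) E1 E2).
      replace (p x * / (u x - h * Ci) - p x * / (u x + h * Ci))%C
        with (p x * (/ (u x - h * Ci) - / (u x + h * Ci)))%C by ring.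
      eapply Rle_trans; [exact E|].
      apply Rmult_le_compat_r; [|apply Rmult_le_compat_r; lra].
      left. apply Rdiv_lt_0_compat; nra.
    - intros x Hx Hxd.
      replace (p x * / (u x - h * Ci) - p x * / (u x + h * Ci))%C
        with (p x * (/ (u x - h * Ci) - / (u x + h * Ci)))%C by ring.
      apply far_jump; auto; lra. }
  assert (T1 := poisson_integral_le_PI h d).
  assert (T2 := poisson_integral_to_PI h d Hh (proj1 Hd)).
  replace (V1 - V2 - 2 * PI * Ci * p0)%C with
    ((V1 - V2 - p0 * (2 * Ci) * (2 * atan (d / h))%R)
     + 2 * Ci * (p0 * (2 * atan (d / h) - PI)%R))%C
    by (rewrite RtoC_minus; ring).
  eapply Rle_trans; [apply Cmod_triangle|].
  assert (T3 : Cmod (2 * Ci * (p0 * (2 * atan (d / h) - PI)%R))%C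
    <= 4 / d * Cmod p0 * h).
  { rewrite !Cmod_mult, Cmod_Ci, !Cmod_R, (Rabs_right 2) by lra.
    replace (4 / d * Cmod p0 * h) with (2 * 1 * (Cmod p0 * (2 * (h / d))))
      by (field; lra).
    apply Rmult_le_compat_l; [lra|]. apply Rmult_le_compat_l; auto.
    apply Rabs_le. lra. }
  assert (HPI := PI_RGT_0). nra.
Qed.

Hypothesis Hmono : exists d, 0 < d /\ forall x y, 0 <= x < y -> y <= d ->
  Cmod (u x) < Cmod (u y) /\ Cmod (u (- x)) < Cmod (u (- y)).

Lemma u_at_0 : u 0 = 0%C.
Proof.
  apply Cmod_eq_0.
  destruct (Hloc 1) as [d [Hd Hl]]; [lra|].
  destruct (Hl 0) as [H _]; [rewrite Rabs_R0; lra|].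
  rewrite Rabs_R0 in H. replace (u 0 - 0)%C with (u 0) in H by ring.
  generalize (Cmod_ge_0 (u 0)). lra.
Qed.

(** Close to the zero, [Cmod (u x) < h] cuts out an interval; this is what
    makes the truncated integrand piecewise continuous. *)
Lemma truncation_interval : forall d, 0 < d <= Q -> exists h0, 0 < h0 /\
  forall h, 0 < h < h0 -> exists a b,
    0 < a < d /\ 0 < b < d /\ Cmod (u (- a)) = h /\ Cmod (u b) = h /\
    forall x, - Q <= x <= Q -> (h <= Cmod (u x) <-> x <= - a \/ b <= x).
Proof.
  intros d Hd. destruct Hmono as [d1 [Hd1 Hm1]].
  set (d2 := Rmin d1 d).
  assert (A1 : d2 <= d1) by apply Rmin_l.
  assert (A2 : d2 <= d) by apply Rmin_r.
  assert (A3 : 0 < d2) by (apply Rmin_pos; lra).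
  destruct (Hfar d2 A3) as [m [Hm Hf]].
  exists m. split; auto. intros h Hh.
  assert (U0 : Cmod (u 0) = 0) by (rewrite u_at_0; apply Cmod_0).
  assert (Up : m <= Cmod (u d2))
    by (apply Hf; [lra|]; rewrite Rabs_right; lra).
  assert (Un : m <= Cmod (u (- d2)))
    by (apply Hf; [lra|]; rewrite Rabs_left; lra).
  assert (Hcont : continuity (fun x => Cmod (u x))).
  { intros x. apply continuity_pt_filterlim.
    apply (continuous_Cmod u), Hcu. }
  destruct (IVT_gen (fun x => Cmod (u x)) 0 d2 h Hcont) as [b [Hb Eb]].
  { rewrite U0, Rmin_left, Rmax_right; lra. }
  destruct (IVT_gen (fun x => Cmod (u x)) (- d2) 0 h Hcont) as [a' [Ha Ea]].
  { rewrite U0, Rmin_right, Rmax_left; lra. }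
  rewrite Rmin_left, Rmax_right in Hb by lra.
  rewrite Rmin_left, Rmax_right in Ha by lra.
  simpl in Eb, Ea.
  assert (Hb0 : b <> 0) by (intros ->; lra).
  assert (Ha0 : a' <> 0) by (intros ->; lra).
  assert (Hbd : b <> d2) by (intros ->; lra).
  assert (Had : a' <> - d2) by (intros ->; lra).
  exists (- a'), b. rewrite Ropp_involutive.
  repeat split; try lra.
  - intros Hx. destruct (Rle_dec x a') as [|H1]; auto.
    destruct (Rle_dec b x) as [|H2]; auto. exfalso.
    destruct (Rle_dec 0 x) as [H3|H3].
    + destruct (Hm1 x b) as [H4 _]; lra.
    + destruct (Hm1 (- x) (- a')) as [_ H4]; [lra|lra|].
      rewrite !Ropp_involutive in H4. lra.
  - intros [Hx|Hx].
    + destruct (Rle_dec x (- d2)) as [H1|H1].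
      * left. eapply Rlt_le_trans; [apply Hh|]. apply Hf; auto.
        rewrite Rabs_left; lra.
      * destruct (Req_dec x a') as [->|H2]; [lra|].
        destruct (Hm1 (- a') (- x)) as [_ H4]; [lra|lra|].
        rewrite !Ropp_involutive in H4. lra.
    + destruct (Rle_dec d2 x) as [H1|H1].
      * left. eapply Rlt_le_trans; [apply Hh|]. apply Hf; auto.
        rewrite Rabs_right; lra.
      * destruct (Req_dec x b) as [->|H2]; [lra|].
        destruct (Hm1 b x) as [H4 _]; lra.
Qed.

Lemma ex_CInt_truncated : exists h0, 0 < h0 /\ forall h, 0 < h < h0 ->
  exists T, is_CInt
    (fun x => (p x * (if Rle_dec h (Cmod (u x)) then / u x else 0))%C)
    (- Q) Q T.
Proof.
  destruct (truncation_interval Q) as [h0 [Hh0 Hi]]; [lra|].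
  exists h0. split; auto. intros h Hh.
  destruct (Hi h Hh) as (a & b & Ha & Hb & _ & _ & Hab).
  assert (Hcont : forall x, - Q <= x <= Q -> x <= - a \/ b <= x ->
    @continuous R_UniformSpace C_UniformSpace (fun x => (p x * / u x)%C) x).
  { intros x Hx Hx2. apply continuous_Cmult; auto. apply continuous_Cinv; auto.
    apply Cmod_gt_0. apply Hab in Hx2; auto. lra. }
  destruct (ex_CInt_continuous (fun x => (p x * / u x)%C) (- Q) (- a))
    as [v1 H1]; [lra|intros x Hx; apply Hcont; lra|].
  destruct (ex_CInt_continuous (fun x => (p x * / u x)%C) b Q)
    as [v2 H2]; [lra|intros x Hx; apply Hcont; lra|].
  exists (v1 + (0 + v2))%C.
  apply is_CInt_join with (- a); [|apply is_CInt_join with b].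
  - apply is_CInt_ext with (3 := H1); [lra|]. intros x Hx.
    destruct (Rle_dec h (Cmod (u x))) as [|H]; auto.
    destruct H. apply Hab; lra.
  - apply is_CInt_ext with (3 := is_CInt_zero _ _); [lra|]. intros x Hx.
    destruct (Rle_dec h (Cmod (u x))) as [H|]; [|ring].
    apply Hab in H; lra.
  - apply is_CInt_ext with (3 := H2); [lra|]. intros x Hx.
    destruct (Rle_dec h (Cmod (u x))) as [|H]; auto.
    destruct H. apply Hab; lra.
Qed.

(** In the model all contributions are odd, so only the difference between
    the lengths [a] and [b] of the two halves of the truncated interval
    remains. *)
Lemma symmetric_model_integral : forall d h a b,
  0 < d <= Q -> 0 < h -> 0 < a < d -> 0 < b < d ->
  (forall x, - Q <= x <= Q -> (h <= Cmod (u x) <-> x <= - a \/ b <= x)) ->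
  is_CInt (fun x => (2 * (x / (x * x + h * h)%R)
     - 2 * (if Rle_dec h (Cmod (u x)) then / x else 0))%C) (- d) d
    (2 * (ln b - ln a)%R)%C.
Proof.
  intros d h a b Hd Hh Ha Hb Hab.
  assert (E : is_CInt (fun x => RtoC (2 * x / (x * x + h * h))) (- d) d 0%C).
  { apply is_CInt_real.
    replace 0 with (ln (d * d + h * h) - ln (- d * - d + h * h)).
    2:{ replace (- d * - d) with (d * d) by ring. ring. }
    apply (is_RInt_derive_R (fun x => ln (x * x + h * h))); [lra| |].
    - intros x _. auto_derive; [nra|]. field. nra.
    - intros x _. apply (ex_derive_continuous (V := R_NormedModule)).
      auto_derive. nra. }
  assert (Fp : is_CInt (fun x => RtoC (/ x)) b d (ln d - ln b)%R).
  { apply is_CInt_real.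
    apply (is_RInt_derive_R ln); [lra| |].
    - intros x Hx. apply is_derive_ln. lra.
    - intros x Hx. apply continuous_Rinv. lra. }
  assert (Fn : is_CInt (fun x => RtoC (/ x)) (- d) (- a) (ln a - ln d)%R).
  { apply is_CInt_real.
    replace (ln a - ln d) with (ln (- - a) - ln (- - d))
      by (rewrite !Ropp_involutive; ring).
    apply (is_RInt_derive_R (fun x => ln (- x))); [lra| |].
    - intros x Hx. auto_derive; [lra|]. field. lra.
    - intros x Hx. apply continuous_Rinv. lra. }
  assert (F : is_CInt
    (fun x => (if Rle_dec h (Cmod (u x)) then / x else 0)%C) (- d) d
    (RtoC (ln a - ln d) + (0 + RtoC (ln d - ln b)))%C).
  { apply is_CInt_join with (- a); [|apply is_CInt_join with b].
    - apply is_CInt_ext with (3 := Fn); [lra|]. intros x Hx.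
      rewrite RtoC_inv by lra.
      destruct (Rle_dec h (Cmod (u x))) as [|H]; auto.
      destruct H. apply Hab; lra.
    - apply is_CInt_ext with (3 := is_CInt_zero _ _); [lra|]. intros x Hx.
      destruct (Rle_dec h (Cmod (u x))) as [H|]; auto.
      apply Hab in H; lra.
    - apply is_CInt_ext with (3 := Fp); [lra|]. intros x Hx.
      rewrite RtoC_inv by lra.
      destruct (Rle_dec h (Cmod (u x))) as [|H]; auto.
      destruct H. apply Hab; lra. }
  replace (2 * (ln b - ln a)%R)%C with
    (0 - 2 * (RtoC (ln a - ln d) + (0 + RtoC (ln d - ln b))))%C
    by (rewrite !RtoC_minus; ring).
  apply is_CInt_minus; [|apply is_CInt_scal; exact F].
  apply is_CInt_ext with (3 := E); [lra|]. intros x _.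
  rewrite RtoC_div by nra. rewrite RtoC_mult. unfold Cdiv. ring.
Qed.

(** The sum of the two kernels, less twice the truncated kernel, has bounded
    mass near the zero and is nearly odd there, so that it integrates to
    nearly nothing against a continuous density. *)
Lemma symmetric_limit : forall e, 0 < e -> exists h0, 0 < h0 /\
  forall h V1 V2 T, 0 < h < h0 ->
    is_CInt (fun x => (p x * / (u x - h * Ci))%C) (- Q) Q V1 ->
    is_CInt (fun x => (p x * / (u x + h * Ci))%C) (- Q) Q V2 ->
    is_CInt (fun x => (p x * (if Rle_dec h (Cmod (u x)) then / u x else 0))%C)
      (- Q) Q T ->
    Cmod (V1 + V2 - 2 * T)%C <= e.
Proof.
  intros e He.
  destruct (near_radius (e / 2)) as
    (eta & d & m & B & Heta & Hd & Hm & HB & Hbudget & Hl & Hf & Hp); [lra|].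
  destruct (small_multiple (2 * Q * (4 * B / (m * m))) (e / 2))
    as [h1 [Hh1 Hs1]]; [lra|].
  destruct (truncation_interval d Hd) as [h2 [Hh2 Hi]].
  exists (Rmin (m / 2) (Rmin h1 h2)).
  split; [repeat apply Rmin_pos; lra|].
  intros h V1 V2 T [Hh Hlt] HV1 HV2 HT.
  assert (L1 : h < m / 2) by (eapply Rlt_le_trans; [exact Hlt|apply Rmin_l]).
  assert (L2 : h < Rmin h1 h2)
    by (eapply Rlt_le_trans; [exact Hlt|apply Rmin_r]).
  assert (L3 : h < h1) by (eapply Rlt_le_trans; [exact L2|apply Rmin_l]).
  assert (L4 : h < h2) by (eapply Rlt_le_trans; [exact L2|apply Rmin_r]).
  specialize (Hs1 h (conj Hh L3)).
  destruct (Hi h (conj Hh L4)) as (a & b & Ha & Hb & Ua & Ub & Hab).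
  assert (HV := is_CInt_minus _ _ _ _ _ _
    (is_CInt_plus _ _ _ _ _ _ HV1 HV2) (is_CInt_scal 2 _ _ _ _ HT)).
  assert (HW := is_CInt_scal p0 _ _ _ _
    (symmetric_model_integral d h a b Hd Hh Ha Hb Hab)).
  assert (Hp0 := Cmod_ge_0 p0).
  assert (HC : Cmod (V1 + V2 - 2 * T - p0 * (2 * (ln b - ln a)%R))%C
     <= (24 + 120 * Cmod p0) * eta * PI + 2 * Q * (4 * B / (m * m) * h)).
  { apply (concentrated_integral _ _ _ _ Q d h
      ((24 + 120 * Cmod p0) * eta) (4 * B / (m * m) * h) Hh
      ltac:(lra) ltac:(nra) HV HW).
    - intros x Hx. destruct (Hl x) as [E1 E2]; [apply Rabs_le; lra|].
      assert (E := near_symmetric (u x) (p x) p0 x h eta Hh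
        (Rlt_le _ _ (proj1 Heta)) (proj2 Heta) E1 E2).
      cbv zeta in E.
      eapply Rle_trans; [|exact E]. right. f_equal. ring.
    - intros x Hx Hxd.
      assert (Hux : m <= Cmod (u x)) by auto.
      destruct (Rle_dec h (Cmod (u x))) as [_|H]; [|lra].
      replace (p x * / (u x - h * Ci) + p x * / (u x + h * Ci)
               - 2 * (p x * / u x))%C
        with (p x * (/ (u x - h * Ci) + / (u x + h * Ci) - 2 * / u x))%C by ring.
      apply far_symmetric; auto; lra. }
  (* [h] is [b], and also [a], times a factor between [1 - eta] and [1 + eta]. *)
  destruct (Hl b) as [Lb _]; [rewrite Rabs_right; lra|].
  destruct (Hl (- a)) as [La _]; [rewrite Rabs_left; lra|].
  rewrite Rabs_right in Lb by lra. rewrite Rabs_left in La by lra.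
  rewrite Ropp_involutive in La.
  assert (Rb : (1 - eta) * b <= h <= (1 + eta) * b).
  { generalize (Cmod_triangle_sub (u b) b) (Cmod_triangle_sub b (u b)).
    rewrite (Cmod_sub_sym b (u b)), Cmod_R, Rabs_right by lra. lra. }
  assert (Ra : (1 - eta) * a <= h <= (1 + eta) * a).
  { generalize (Cmod_triangle_sub (u (- a)) (- a)%R)
      (Cmod_triangle_sub (- a)%R (u (- a))).
    rewrite (Cmod_sub_sym (- a)%R (u (- a))), Cmod_R, Rabs_left by lra. lra. }
  assert (Hratio : forall s t, 0 < s -> 0 < t -> (1 - eta) * s <= h ->
    h <= (1 + eta) * t -> ln s - ln t <= 4 * eta).
  { intros s t Hs Ht H1 H2. rewrite <- ln_div by auto.
    eapply Rle_trans; [apply ln_le_sub1, Rdiv_lt_0_compat; auto|].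
    apply (Rmult_le_reg_r t); auto.
    replace ((s / t - 1) * t) with (s - t) by (field; lra).
    assert (0 <= eta * (1 - 2 * eta) * t)
      by (repeat apply Rmult_le_pos; lra).
    assert (s * (1 - eta) <= (1 + 4 * eta) * t * (1 - eta)) by lra.
    assert (s <= (1 + 4 * eta) * t) by (apply (Rmult_le_reg_r (1 - eta)); lra).
    lra. }
  assert (Hln : Rabs (ln b - ln a) <= 4 * eta).
  { apply Rabs_le.
    assert (X1 := Hratio a b ltac:(lra) ltac:(lra) (proj1 Ra) (proj2 Rb)).
    assert (X2 := Hratio b a ltac:(lra) ltac:(lra) (proj1 Rb) (proj2 Ra)). lra. }
  replace (V1 + V2 - 2 * T)%C with
    ((V1 + V2 - 2 * T - p0 * (2 * (ln b - ln a)%R))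
     + p0 * (2 * (ln b - ln a)%R))%C by ring.
  eapply Rle_trans; [apply Cmod_triangle|].
  assert (T3 : Cmod (p0 * (2 * (ln b - ln a)%R))%C <= Cmod p0 * (2 * (4 * eta))).
  { rewrite !Cmod_mult, !Cmod_R, (Rabs_right 2) by lra.
    apply Rmult_le_compat_l; auto. lra. }
  assert (HPI := PI_RGT_0). nra.
Qed.

End SimpleZero.

(** * Periodic functions *)

Lemma periodic_nat : forall (T : Type) (g : R -> T) P,
  (forall s, g (s + P) = g s) -> forall (n : nat) s, g (s + INR n * P) = g s.
Proof.
  intros T g P Hg n. induction n as [|n IH]; intros s.
  - simpl. f_equal. ring.
  - rewrite S_INR. replace (s + (INR n + 1) * P) with (s + INR n * P + P) by ring.
    rewrite Hg. apply IH.
Qed.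

Lemma periodic_Z : forall (T : Type) (g : R -> T) P,
  (forall s, g (s + P) = g s) -> forall (k : Z) s, g (s + IZR k * P) = g s.
Proof.
  intros T g P Hg k s. destruct (Z_le_gt_dec 0 k) as [Hk|Hk].
  - rewrite <- (Z2Nat.id k Hk), <- INR_IZR_INZ. apply periodic_nat, Hg.
  - rewrite <- (periodic_nat T g P Hg (Z.to_nat (- k)) (s + IZR k * P)).
    rewrite INR_IZR_INZ, Z2Nat.id, opp_IZR by lia. f_equal. ring.
Qed.

Lemma period_reduction : forall P a s, 0 < P ->
  exists k : Z, a <= s + IZR k * P < a + P.
Proof.
  intros P a s HP. destruct (base_Int_part ((s - a) / P)) as [H1 H2].
  exists (- Int_part ((s - a) / P))%Z. rewrite opp_IZR.
  set (n := IZR (Int_part ((s - a) / P))) in *.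
  assert (E : (s - a) / P * P = s - a) by (field; lra).
  assert (A1 : n * P <= (s - a) / P * P) by (apply Rmult_le_compat_r; lra).
  assert (A2 : (s - a) / P * P < (n + 1) * P)
    by (apply Rmult_lt_compat_r; lra).
  lra.
Qed.

Lemma periodic_CInt : forall (g : R -> C) P a b (v : C), 0 < P ->
  (forall s, g (s + P) = g s) ->
  is_CInt g a (a + P) v -> is_CInt g b (b + P) v.
Proof.
  intros g P a b v HP Hg Hv.
  destruct (period_reduction P b a HP) as [k Hk].
  set (a' := a + IZR k * P) in *.
  assert (H1 : is_CInt g a' (a' + P) v).
  { apply is_CInt_ext with (fun x => g (x + - (IZR k * P))); [lra| |].
    - intros x _. rewrite <- (periodic_Z C g P Hg k (x + - (IZR k * P))).
      f_equal. ring.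
    - apply is_CInt_shift. unfold a'.
      replace (a + IZR k * P + - (IZR k * P)) with a by ring.
      replace (a + IZR k * P + P + - (IZR k * P)) with (a + P) by ring.
      exact Hv. }
  destruct (is_CInt_split g a' (b + P) (a' + P) v) as (v1 & v2 & I1 & I2 & E);
    [lra|auto|].
  rewrite <- E, Cplus_comm. apply is_CInt_join with a'; auto.
  apply is_CInt_ext with (fun x => g (x + P)); [lra|auto|].
  apply is_CInt_shift. exact I2.
Qed.

(** * Contour integrals *)

Lemma dgam_periodic : forall c s, dgam c (s + period c) = dgam c s.
Proof.
  intros c s.
  assert (H : forall t, is_derive (fun y => y + period c) t 1)
    by (intros t; auto_derive; auto).
  apply injective_projections.
  - rewrite <- (is_derive_unique _ _ _ (is_derive_Cfst _ _ _ (gam_derive c s))).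
    symmetry. apply is_derive_unique.
    apply is_derive_ext with (fun y => fst (gam c (y + period c))).
    { intros t. rewrite gam_periodic. reflexivity. }
    rewrite <- (Rmult_1_l (fst (dgam c (s + period c)))).
    apply (is_derive_comp (fun y => fst (gam c y)) (fun y => y + period c));
      auto.
    apply is_derive_Cfst, gam_derive.
  - rewrite <- (is_derive_unique _ _ _ (is_derive_Csnd _ _ _ (gam_derive c s))).
    symmetry. apply is_derive_unique.
    apply is_derive_ext with (fun y => snd (gam c (y + period c))).
    { intros t. rewrite gam_periodic. reflexivity. }
    rewrite <- (Rmult_1_l (snd (dgam c (s + period c)))).
    apply (is_derive_comp (fun y => snd (gam c y)) (fun y => y + period c));
      auto.
    apply is_derive_Csnd, gam_derive.
Qed.

Lemma gam_continuous : forall c s,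
  @continuous R_UniformSpace C_UniformSpace (gam c) s.
Proof.
  intros c s. apply continuous_Cpair;
    apply (ex_derive_continuous (V := R_NormedModule)); eexists.
  - apply is_derive_Cfst, gam_derive.
  - apply is_derive_Csnd, gam_derive.
Qed.

Definition continuous_along (c : jordan_curve) (g : C -> C) : Prop :=
  forall s, @continuous R_UniformSpace C_UniformSpace (fun s => g (gam c s)) s.

Lemma periodic_bounded : forall (c : jordan_curve) (f : R -> C),
  (forall s, @continuous R_UniformSpace C_UniformSpace f s) ->
  (forall s, f (s + period c) = f s) ->
  exists B, 0 < B /\ forall s, Cmod (f s) <= B.
Proof.
  intros c f Hf Hp.
  destruct (continuous_bounded f 0 (period c)) as [B [HB Hb]]; [auto|].
  exists B. split; auto. intros s.
  destruct (period_reduction (period c) 0 s (period_gt0 c)) as [k Hk].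
  rewrite <- (periodic_Z C f _ Hp k s). apply Hb. lra.
Qed.

Lemma off_curve_distance : forall c z, ~ on_curve c z ->
  exists r, 0 < r /\ forall s, r <= Cmod (gam c s - z)%C.
Proof.
  intros c z Hz. assert (HP := period_gt0 c).
  destruct (continuous_attains_min (fun s => Cmod (gam c s - z)%C) 0 (period c))
    as [s0 [H0 Hmin]]; [lra| |].
  { intros x _. apply (continuous_Cmod (fun s => (gam c s - z)%C)).
    apply continuous_Cminus; [apply gam_continuous|apply continuous_Cconst]. }
  exists (Cmod (gam c s0 - z)%C). split.
  - apply Cmod_gt_0. intros H. apply Hz. exists s0.
    replace (gam c s0) with ((gam c s0 - z) + z)%C by ring. rewrite H. ring.
  - intros s.
    destruct (period_reduction (period c) 0 s HP) as [k Hk].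
    rewrite <- (periodic_Z C (gam c) _ (gam_periodic c) k s).
    apply (Hmin (s + IZR k * period c)). lra.
Qed.

Lemma distance_off_curve : forall c z r, 0 < r ->
  (forall s, r <= Cmod (gam c s - z)%C) -> ~ on_curve c z.
Proof.
  intros c z r Hr H [s Hs]. specialize (H s). rewrite Hs in H.
  replace (z - z)%C with (RtoC 0) in H by ring. rewrite Cmod_0 in H. lra.
Qed.

Lemma off_curve_sub_neq0 : forall c z s, ~ on_curve c z ->
  (gam c s - z)%C <> 0%C.
Proof.
  intros c z s Hz H. apply Hz. exists s.
  replace (gam c s) with ((gam c s - z) + z)%C by ring. rewrite H. ring.
Qed.

Lemma contour_int_spec : forall c g, continuous_along c g ->
  is_contour_int c g (contour_int c g).
Proof.
  intros c g Hg. assert (HP := period_gt0 c).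
  destruct (ex_CInt_continuous (fun s => (g (gam c s) * dgam c s)%C)
    0 (period c)) as [v Hv]; [lra| |].
  { intros x _. apply continuous_Cmult; [apply Hg|apply dgam_continuous]. }
  unfold contour_int. rewrite (CInt_components _ _ _ _ Hv). exact Hv.
Qed.

Lemma contour_int_unique : forall c g v,
  is_contour_int c g v -> contour_int c g = v.
Proof. intros c g v Hv. exact (CInt_components _ _ _ _ Hv). Qed.

(** Centring the period at [s0] keeps the singular point of the Cauchy kernel
    away from the ends of the interval of integration. *)
Lemma contour_int_centred : forall c g s0 v,
  is_contour_int c g v <->
  is_CInt (fun x => (g (gam c (s0 + x)) * dgam c (s0 + x))%C)
    (- (period c / 2)) (period c / 2) v.
Proof.
  intros c g s0 v.
  set (f := fun s => (g (gam c s) * dgam c s)%C).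
  assert (HP := period_gt0 c).
  assert (Hf : forall s, f (s + period c) = f s).
  { intros s. unfold f. rewrite gam_periodic, dgam_periodic. reflexivity. }
  split; intros H.
  - apply is_CInt_ext with (fun x => f (x + s0)); [lra| |].
    { intros x _. unfold f. rewrite Rplus_comm. reflexivity. }
    apply is_CInt_shift.
    replace (period c / 2 + s0) with (- (period c / 2) + s0 + period c) by field.
    apply (periodic_CInt f (period c) 0); auto.
    rewrite Rplus_0_l. exact H.
  - change (is_CInt f 0 (period c) v).
    rewrite <- (Rplus_0_l (period c)).
    apply (periodic_CInt f (period c) (- (period c / 2) + s0)); auto.
    replace (- (period c / 2) + s0 + period c) with (period c / 2 + s0) by field.
    apply is_CInt_ext with
      (fun x => (g (gam c (s0 + (x + - s0))) * dgam c (s0 + (x + - s0)))%C);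
      [lra| |].
    { intros x _. unfold f. replace (s0 + (x + - s0)) with x by ring.
      reflexivity. }
    apply (is_CInt_shift
      (fun x => (g (gam c (s0 + x)) * dgam c (s0 + x))%C)).
    replace (- (period c / 2) + s0 + - s0) with (- (period c / 2)) by ring.
    replace (period c / 2 + s0 + - s0) with (period c / 2) by ring.
    exact H.
Qed.

Lemma continuous_along_pole : forall c f z, continuous_along c f ->
  ~ on_curve c z -> continuous_along c (fun t => (f t / (t - z))%C).
Proof.
  intros c f z Hf Hz s. apply continuous_Cdiv; [apply Hf| |].
  - apply continuous_Cminus; [apply gam_continuous|apply continuous_Cconst].
  - apply off_curve_sub_neq0, Hz.
Qed.

Lemma cauchy_integral_decay : forall c f, continuous_along c f ->
  forall e, 0 < e -> exists r, 0 < r /\ forall z, r <= Cmod z ->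
    ~ on_curve c z /\
    Cmod (contour_int c (fun t => f t / (t - z))%C) <= e.
Proof.
  intros c f Hf e He. assert (HP := period_gt0 c).
  destruct (periodic_bounded c (gam c) (gam_continuous c) (gam_periodic c))
    as [B [HB Hg]].
  destruct (periodic_bounded c (fun s => (f (gam c s) * dgam c s)%C))
    as [M [HM Hm]].
  { intros s. apply continuous_Cmult; [apply Hf|apply dgam_continuous]. }
  { intros s. rewrite gam_periodic, dgam_periodic. reflexivity. }
  set (K := period c * M / e).
  assert (HK : 0 < K).
  { apply Rdiv_lt_0_compat; auto. apply Rmult_lt_0_compat; auto. }
  exists (B + K). split; [lra|]. intros z Hz.
  assert (Hd : forall s, K <= Cmod (gam c s - z)%C).
  { intros s. rewrite Cmod_sub_sym.
    generalize (Cmod_triangle_sub z (gam c s)) (Hg s). lra. }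
  assert (Hoff := distance_off_curve c z K HK Hd).
  split; auto.
  assert (HI := contour_int_spec c _ (continuous_along_pole c f z Hf Hoff)).
  replace e with ((period c - 0) * (M / K)) by (unfold K; field; lra).
  eapply is_CInt_bound_const with (3 := HI); [lra|].
  intros s _. simpl.
  assert (Hn := off_curve_sub_neq0 c z s Hoff).
  replace (f (gam c s) / (gam c s - z) * dgam c s)%C
    with (f (gam c s) * dgam c s / (gam c s - z))%C by (field; auto).
  rewrite Cmod_div by auto.
  unfold Rdiv. apply Rmult_le_compat; auto.
  - apply Cmod_ge_0.
  - left. apply Rinv_0_lt_compat. eapply Rlt_le_trans; [exact HK|auto].
  - apply Rinv_le_contravar; auto.
Qed.

(** * Winding numbers *)

(** [2 * PI * Ci] times the winding number around [z]. *)
Definition winding (c : jordan_curve) (z : C) : C :=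
  contour_int c (fun t => / (t - z))%C.

Lemma continuous_along_inv : forall c z, ~ on_curve c z ->
  continuous_along c (fun t => / (t - z))%C.
Proof.
  intros c z Hz s. apply continuous_Cinv.
  - apply continuous_Cminus; [apply gam_continuous|apply continuous_Cconst].
  - apply off_curve_sub_neq0, Hz.
Qed.

Lemma is_derive_opp_inv : forall (a b : R -> R) s a' b',
  is_derive a s a' -> is_derive b s b' -> a s * a s + b s * b s <> 0 ->
  is_derive (fun s => - fst (/ (a s, b s))%C) s
    (fst (/ (a s, b s) * / (a s, b s) * (a', b'))%C) /\
  is_derive (fun s => - snd (/ (a s, b s))%C) s
    (snd (/ (a s, b s) * / (a s, b s) * (a', b'))%C).
Proof.
  intros a b s a' b' Ha Hb Hn. simpl.
  assert (X1 : ex_derive a s) by (eexists; exact Ha).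
  assert (X2 : ex_derive b s) by (eexists; exact Hb).
  assert (U1 : Derive (fun x => a x) s = a') by (apply is_derive_unique; exact Ha).
  assert (U2 : Derive (fun x => b x) s = b') by (apply is_derive_unique; exact Hb).
  assert (Hn' : a s * (a s * 1) + b s * (b s * 1) <> 0)
    by (intros H; apply Hn; rewrite <- H; ring).
  split; auto_derive; repeat split; auto; rewrite U1, U2; field; auto.
Qed.

(** The integrand is the derivative of [- / (gam c s - z)], which is
    periodic. *)
Lemma double_pole_integral : forall c z, ~ on_curve c z ->
  is_contour_int c (fun t => / (t - z) * / (t - z))%C 0%C.
Proof.
  intros c z Hz. assert (HP := period_gt0 c).
  set (g := fun s => (/ (gam c s - z) * / (gam c s - z) * dgam c s)%C).
  assert (Hg : forall s, @continuous R_UniformSpace C_UniformSpace g s).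
  { intros s. apply continuous_Cmult; [|apply dgam_continuous].
    apply continuous_Cmult; apply (continuous_along_inv c z Hz). }
  assert (Hn : forall s, fst (gam c s - z)%C * fst (gam c s - z)%C
    + snd (gam c s - z)%C * snd (gam c s - z)%C <> 0).
  { intros s H. apply (off_curve_sub_neq0 c z s Hz).
    apply injective_projections.
    - exact (proj1 (Rplus_sqr_eq_0 _ _ H)).
    - exact (proj2 (Rplus_sqr_eq_0 _ _ H)). }
  assert (D : forall s,
    is_derive (fun s => - fst (/ (gam c s - z))%C) s (fst (g s)) /\
    is_derive (fun s => - snd (/ (gam c s - z))%C) s (snd (g s))).
  { intros s.
    destruct (is_derive_opp_inv (fun s => fst (gam c s - z)%C)
      (fun s => snd (gam c s - z)%C) s (fst (dgam c s)) (snd (dgam c s)))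
      as [D1 D2]; [| |apply Hn|split; assumption].
    - simpl. rewrite <- (Rplus_0_r (fst (dgam c s))).
      apply @is_derive_plus;
        [apply is_derive_Cfst, gam_derive|apply @is_derive_const].
    - simpl. rewrite <- (Rplus_0_r (snd (dgam c s))).
      apply @is_derive_plus;
        [apply is_derive_Csnd, gam_derive|apply @is_derive_const]. }
  assert (E : gam c (period c) = gam c 0).
  { rewrite <- (Rplus_0_l (period c)). apply gam_periodic. }
  assert (I1 := is_RInt_derive_R (fun s => - fst (/ (gam c s - z))%C)
    (fun s => fst (g s)) 0 (period c) (Rlt_le _ _ HP)
    (fun s _ => proj1 (D s)) (fun s _ => continuous_Cfst g s (Hg s))).
  assert (I2 := is_RInt_derive_R (fun s => - snd (/ (gam c s - z))%C)
    (fun s => snd (g s)) 0 (period c) (Rlt_le _ _ HP)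
    (fun s _ => proj2 (D s)) (fun s _ => continuous_Csnd g s (Hg s))).
  cbv beta in I1, I2. rewrite E, Rminus_diag in I1, I2.
  exact (is_CInt_pair g 0 (period c) 0%C I1 I2).
Qed.

(** The first-order term of the expansion of the winding number in [w - z] is
    the integral of a double pole, hence vanishes. *)
Lemma winding_second_order : forall c r, 0 < r -> exists K, 0 <= K /\
  forall z w, (forall s, r <= Cmod (gam c s - z)%C) ->
    (forall s, r <= Cmod (gam c s - w)%C) ->
    Cmod (winding c w - winding c z)%C <= K * (Cmod (w - z)%C * Cmod (w - z)%C).
Proof.
  intros c r Hr. assert (HP := period_gt0 c).
  destruct (periodic_bounded c (dgam c) (dgam_continuous c) (dgam_periodic c))
    as [M [HM Hm]].
  exists (period c * (M / (r * (r * r)))). split.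
  { apply Rmult_le_pos; [lra|].
    apply Rdiv_le_0_compat; [lra|]. repeat apply Rmult_lt_0_compat; auto. }
  intros z w Hz Hw.
  assert (Oz := distance_off_curve c z r Hr Hz).
  assert (Ow := distance_off_curve c w r Hr Hw).
  assert (Iz := contour_int_spec c _ (continuous_along_inv c z Oz)).
  assert (Iw := contour_int_spec c _ (continuous_along_inv c w Ow)).
  assert (I2 := is_CInt_scal (w - z)%C _ _ _ _ (double_pole_integral c z Oz)).
  assert (I := is_CInt_minus _ _ _ _ _ _ (is_CInt_minus _ _ _ _ _ _ Iw Iz) I2).
  fold (winding c z) in I. fold (winding c w) in I.
  replace (winding c w - winding c z - (w - z) * 0)%C
    with (winding c w - winding c z)%C in I by ring.
  replace (period c * (M / (r * (r * r))) * (Cmod (w - z)%C * Cmod (w - z)%C))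
    with ((period c - 0) * (M / (r * (r * r)) * (Cmod (w - z)%C * Cmod (w - z)%C)))
    by (unfold Rdiv; ring).
  eapply is_CInt_bound_const with (3 := I); [lra|].
  intros s _. simpl.
  assert (Nz := off_curve_sub_neq0 c z s Oz).
  assert (Nw := off_curve_sub_neq0 c w s Ow).
  replace (/ (gam c s - w) * dgam c s - / (gam c s - z) * dgam c s -
    (w - z) * (/ (gam c s - z) * / (gam c s - z) * dgam c s))%C with
    (dgam c s / ((gam c s - w) * ((gam c s - z) * (gam c s - z)))
     * ((w - z) * (w - z)))%C by (field; auto).
  rewrite Cmod_mult, Cmod_div, !Cmod_mult by (repeat apply Cmult_neq_0; auto).
  apply Rmult_le_compat_r; [apply Rmult_le_pos; apply Cmod_ge_0|].
  assert (r * r <= Cmod (gam c s - z)%C * Cmod (gam c s - z)%C)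
    by (apply Rmult_le_compat; auto; lra).
  assert (0 < r * r) by (apply Rmult_lt_0_compat; auto).
  unfold Rdiv. apply Rmult_le_compat; auto.
  - apply Cmod_ge_0.
  - left. apply Rinv_0_lt_compat. apply Rmult_lt_0_compat; [|lra].
    eapply Rlt_le_trans; [exact Hr|auto].
  - apply Rinv_le_contravar; [apply Rmult_lt_0_compat; auto|].
    apply Rmult_le_compat; auto; lra.
Qed.

Lemma is_derive_0_of_quadratic : forall (f : R -> C) t K,
  (forall t', Rabs (t' - t) < 1 ->
     Cmod (f t' - f t)%C <= K * (Rabs (t' - t) * Rabs (t' - t))) ->
  @is_derive R_AbsRing C_R_NormedModule f t zero.
Proof.
  intros f t K H. split; [apply is_linear_scal_l|].
  intros x Hx e.
  assert (Ex : t = x) by exact (is_filter_lim_locally_unique t x Hx).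
  subst x.
  destruct (small_multiple K e (cond_pos e)) as [h0 [Hh0 Hs]].
  assert (Hm : 0 < Rmin 1 h0) by (apply Rmin_pos; lra).
  exists (mkposreal _ Hm). intros y Hy.
  change (Rabs (y - t) < Rmin 1 h0) in Hy.
  rewrite norm_C_R.
  rewrite (@scal_zero_r R_AbsRing C_R_NormedModule).
  rewrite (@minus_zero_r (NormedModule.AbelianGroup _ C_R_NormedModule)).
  change (Cmod (f y - f t)%C <= e * Rabs (y - t)).
  assert (H1 : Rabs (y - t) < 1)
    by (eapply Rlt_le_trans; [exact Hy|apply Rmin_l]).
  assert (H2 : Rabs (y - t) < h0)
    by (eapply Rlt_le_trans; [exact Hy|apply Rmin_r]).
  eapply Rle_trans; [apply H, H1|].
  assert (H3 := Rabs_pos (y - t)).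
  destruct (Req_dec (Rabs (y - t)) 0) as [->|H4]; [lra|].
  rewrite <- Rmult_assoc. apply Rmult_le_compat_r; auto. apply Hs. lra.
Qed.

(** Along a segment that avoids the curve the winding number has derivative
    [0]. *)
Lemma winding_locally_constant : forall c z, ~ on_curve c z ->
  exists r, 0 < r /\ forall w, Cmod (w - z)%C < r ->
    ~ on_curve c w /\ winding c w = winding c z.
Proof.
  intros c z Hz.
  destruct (off_curve_distance c z Hz) as [r [Hr Hd]].
  destruct (winding_second_order c (r / 2)) as [K [HK HT]]; [lra|].
  exists (r / 4). split; [lra|]. intros w Hw.
  assert (Hp : forall t, Rabs t <= 2 -> forall s,
    r / 2 <= Cmod (gam c s - (z + t * (w - z)))%C).
  { intros t Ht s.
    replace (gam c s - (z + t * (w - z)))%C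
      with ((gam c s - z) - t * (w - z))%C by ring.
    eapply Rle_trans; [|apply Cmod_triangle_sub].
    rewrite Cmod_mult, Cmod_R. generalize (Hd s).
    assert (H1 := Cmod_ge_0 (w - z)%C). assert (H2 := Rabs_pos t). nra. }
  split.
  - apply (distance_off_curve c w (r / 2)); [lra|]. intros s.
    replace w with (z + 1%R * (w - z))%C at 1 by ring.
    apply Hp. rewrite Rabs_R1. lra.
  - set (f := fun t : R => winding c (z + t * (w - z))%C).
    assert (E : f 0 = f 1).
    { apply (eq_is_derive (V := C_R_NormedModule) f 0 1); [|lra].
      intros t Ht.
      apply is_derive_0_of_quadratic
        with (K := K * (Cmod (w - z)%C * Cmod (w - z)%C)).
      intros t' Ht'. apply Rabs_def2 in Ht'. unfold f.
      eapply Rle_trans; [apply HT; apply Hp; apply Rabs_le; lra|].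
      replace (z + t' * (w - z) - (z + t * (w - z)))%C
        with ((t' - t)%R * (w - z))%C by (rewrite RtoC_minus; ring).
      rewrite Cmod_mult, Cmod_R. right. ring. }
    unfold f in E.
    replace (z + 0%R * (w - z))%C with z in E by ring.
    replace (z + 1%R * (w - z))%C with w in E by ring.
    symmetry. exact E.
Qed.

(** The sets where the winding number equals, and differs from, its value at
    [z] are open and would disconnect a connected set on which both occur. *)
Lemma winding_same_component : forall c z w,
  same_component c z w -> winding c w = winding c z.
Proof.
  intros c z w [A [HA [Hoff [Az Aw]]]].
  destruct (excluded_middle_informative (winding c w = winding c z))
    as [|Hne]; auto. exfalso.
  destruct (HA (fun v => ~ on_curve c v /\ winding c v = winding c z)
               (fun v => ~ on_curve c v /\ winding c v <> winding c z))
    as [v [_ [[_ H1] [_ H2]]]]; auto.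
  - intros v [Hv E]. destruct (winding_locally_constant c v Hv) as [r [Hr H]].
    apply disc_locally with r; auto. intros y Hy.
    destruct (H y Hy) as [H1 H2]. rewrite H2. auto.
  - intros v [Hv E]. destruct (winding_locally_constant c v Hv) as [r [Hr H]].
    apply disc_locally with r; auto. intros y Hy.
    destruct (H y Hy) as [H1 H2]. rewrite H2. auto.
  - intros v Hv. destruct (excluded_middle_informative
      (winding c v = winding c z)); auto.
  - exists z. auto.
  - exists w. auto.
Qed.

(** The winding number is constant on the component of [z], which is unbounded
    and so reaches points where the Cauchy integral of [1] is arbitrarily
    small. *)
Lemma winding_outside : forall c z, outside c z -> winding c z = 0%C.
Proof.
  intros c z [Hz Hub].
  apply Cmod_eq_0. apply Rle_antisym; [|apply Cmod_ge_0].
  apply le_epsilon. intros e He. rewrite Rplus_0_l.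
  destruct (cauchy_integral_decay c (fun _ => 1%C)) with e
    as [r [Hr Hd]]; auto.
  { intros s. apply continuous_Cconst. }
  destruct (excluded_middle_informative
    (exists w, same_component c z w /\ r < Cmod w)) as [[w [Hw Hl]]|Hno].
  - rewrite <- (winding_same_component c z w Hw).
    destruct (Hd w) as [Hoff Hb]; [lra|].
    replace (winding c w) with (contour_int c (fun t => 1 / (t - w))%C); auto.
    apply contour_int_unique.
    apply is_CInt_ext with (3 := contour_int_spec c _
      (continuous_along_inv c w Hoff)); [left; apply period_gt0|].
    intros s _. unfold Cdiv. ring.
  - exfalso. apply Hub. exists r. intros w Hw.
    destruct (Rle_dec (Cmod w) r) as [|H]; auto.
    exfalso. apply Hno. exists w. split; auto. lra.
Qed.

Lemma two_pi_i_neq0 : (2 * PI * Ci)%C <> 0%C.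
Proof.
  assert (H := PI_RGT_0).
  intros E. apply (f_equal snd) in E. simpl in E. lra.
Qed.

Lemma winding_inside : forall c z, counterclockwise c -> inside c z ->
  winding c z = (2 * PI * Ci)%C.
Proof.
  intros c z Hc Hz. specialize (Hc z Hz). fold (winding c z) in Hc.
  transitivity (2 * PI * Ci * (/ (2 * PI * Ci) * winding c z))%C.
  - field. repeat split; try apply C1_nz; generalize two_pi_i_neq0; intros H E;
    apply H; rewrite E; ring.
  - rewrite Hc. ring.
Qed.

Lemma inside_or_outside : forall c z, ~ on_curve c z ->
  inside c z \/ outside c z.
Proof.
  intros c z Hz. destruct (excluded_middle_informative (bounded_component c z)).
  - left. split; auto.
  - right. split; auto.
Qed.

Lemma inside_open : forall c z, counterclockwise c -> inside c z ->
  exists r, 0 < r /\ forall w, Cmod (w - z)%C < r -> inside c w.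
Proof.
  intros c z Hc Hz.
  destruct (winding_locally_constant c z (proj1 Hz)) as [r [Hr H]].
  exists r. split; auto. intros w Hw. destruct (H w Hw) as [H1 H2].
  destruct (inside_or_outside c w H1) as [|Hout]; auto. exfalso.
  apply two_pi_i_neq0.
  rewrite <- (winding_inside c z Hc Hz), <- H2. apply winding_outside, Hout.
Qed.

Lemma is_derive_shifted_sqr : forall (a b : R -> R) s x p q a' b',
  is_derive a (s + x) a' -> is_derive b (s + x) b' ->
  is_derive (fun y => (a (s + y) + - p) * (a (s + y) + - p)
                    + (b (s + y) + - q) * (b (s + y) + - q)) x
    (2 * ((a (s + x) + - p) * a' + (b (s + x) + - q) * b')).
Proof.
  intros a b s x p q a' b' Ha Hb.
  assert (X1 : ex_derive a (s + x)) by (eexists; exact Ha).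
  assert (X2 : ex_derive b (s + x)) by (eexists; exact Hb).
  assert (U1 : Derive (fun y => a y) (s + x) = a')
    by (apply is_derive_unique; exact Ha).
  assert (U2 : Derive (fun y => b y) (s + x) = b')
    by (apply is_derive_unique; exact Hb).
  auto_derive; auto. rewrite U1, U2. ring.
Qed.

(** * The curve near one of its points *)

Section LocalParameter.
Variables (c : jordan_curve) (s0 : R).

Let P := period c.
Let Q := P / 2.
Let z0 := gam c s0.
Let g0 := dgam c s0.

(** The curve in the affine coordinate in which it passes through [0] at
    parameter [0] with velocity [1]. *)
Let u (x : R) : C := ((gam c (s0 + x) - z0) / g0)%C.
Let du (x : R) : C := (dgam c (s0 + x) / g0)%C.

Lemma local_Q_pos : 0 < Q.
Proof. unfold Q. generalize (period_gt0 c). fold P. lra. Qed.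

Lemma local_g0_neq0 : g0 <> 0%C.
Proof. apply gam_regular. Qed.

Lemma local_g0_pos : 0 < Cmod g0.
Proof. apply Cmod_gt_0, local_g0_neq0. Qed.

Lemma continuous_shifted : forall (f : R -> C) x,
  (forall s, @continuous R_UniformSpace C_UniformSpace f s) ->
  @continuous R_UniformSpace C_UniformSpace (fun x => f (s0 + x)) x.
Proof.
  intros f x Hf. apply (continuous_comp (fun y => s0 + y) f); [|apply Hf].
  apply (ex_derive_continuous (V := R_NormedModule)). auto_derive. auto.
Qed.

Lemma local_u_continuous : forall x,
  @continuous R_UniformSpace C_UniformSpace u x.
Proof.
  intros x. apply continuous_Cdiv;
    [|apply continuous_Cconst|apply local_g0_neq0].
  apply continuous_Cminus; [|apply continuous_Cconst].
  apply continuous_shifted, gam_continuous.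
Qed.

Lemma local_du_continuous : forall x,
  @continuous R_UniformSpace C_UniformSpace du x.
Proof.
  intros x. apply continuous_Cdiv;
    [|apply continuous_Cconst|apply local_g0_neq0].
  apply continuous_shifted, dgam_continuous.
Qed.

Lemma local_du_0 : du 0 = 1%C.
Proof.
  unfold du. rewrite Rplus_0_r. fold g0. field. apply local_g0_neq0.
Qed.

Lemma local_u_near : forall eta, 0 < eta -> exists d, 0 < d /\
  forall x, Rabs x <= d -> Cmod (u x - x)%C <= eta * Rabs x.
Proof.
  intros eta He. assert (Hg := local_g0_pos).
  destruct (is_derive_Cbound _ _ _ (gam_derive c s0) (eta * Cmod g0))
    as [d [Hd H]]; [apply Rmult_lt_0_compat; auto|].
  exists (d / 2). split; [lra|]. intros x Hx.
  specialize (H (s0 + x)). replace (s0 + x - s0) with x in H by ring.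
  replace (u x - x)%C with ((gam c (s0 + x) - z0 - x * g0) / g0)%C
    by (unfold u; field; apply local_g0_neq0).
  rewrite Cmod_div by apply local_g0_neq0.
  apply (Rmult_le_reg_r (Cmod g0)); auto.
  unfold Rdiv. rewrite Rmult_assoc, Rinv_l, Rmult_1_r by lra.
  unfold z0, g0 in *. lra.
Qed.

Lemma local_u_far : forall d, 0 < d -> exists m, 0 < m /\
  forall x, - Q <= x <= Q -> d <= Rabs x -> m <= Cmod (u x).
Proof.
  intros d Hd. assert (HQ := local_Q_pos).
  destruct (Rle_dec d Q) as [HdQ|HdQ].
  2:{ exists 1. split; [lra|]. intros x Hx Hdx. exfalso.
      apply HdQ. eapply Rle_trans; [exact Hdx|]. apply Rabs_le, Hx. }
  destruct (continuous_attains_min (fun x => Cmod (u x)) d (P - d))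
    as [x0 [Hx0 Hmin]]; [unfold Q in *; lra| |].
  { intros x _. apply (continuous_Cmod u), local_u_continuous. }
  exists (Cmod (u x0)). split.
  - apply Cmod_gt_0. intros H0.
    assert (E : gam c (s0 + x0) = gam c s0).
    { replace (gam c (s0 + x0)) with (u x0 * g0 + z0)%C
        by (unfold u; field; apply local_g0_neq0).
      rewrite H0. unfold z0. ring. }
    destruct (period_reduction P 0 s0 (period_gt0 c)) as [k Hk].
    destruct (period_reduction P 0 (s0 + x0) (period_gt0 c)) as [l Hl].
    assert (Es : s0 + IZR k * P = s0 + x0 + IZR l * P).
    { apply (gam_simple c); fold P; [lra|lra|].
      rewrite !(periodic_Z C (gam c) _ (gam_periodic c)). auto. }
    assert (Ex : x0 = IZR (k - l) * P) by (rewrite minus_IZR; lra).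
    assert (B1 : 0 < IZR (k - l)).
    { apply (Rmult_lt_reg_r P); [apply period_gt0|]. lra. }
    assert (B2 : IZR (k - l) < 1).
    { apply (Rmult_lt_reg_r P); [apply period_gt0|]. lra. }
    apply lt_IZR in B1. apply lt_IZR in B2. lia.
  - intros x Hx Hdx. destruct (Rle_dec 0 x) as [H0|H0].
    + apply Hmin. rewrite Rabs_right in Hdx by lra. unfold Q in *. lra.
    + rewrite Rabs_left in Hdx by lra.
      replace (u x) with (u (x + P)).
      * apply Hmin. unfold Q in *. lra.
      * unfold u. replace (s0 + (x + P)) with (s0 + x + P) by ring.
        unfold P. rewrite gam_periodic. reflexivity.
Qed.

Lemma Cmod_sqr : forall w : C, Cmod w * Cmod w = fst w * fst w + snd w * snd w.
Proof.
  intros w. generalize (Cmod2_alt w). unfold Re, Im. simpl. lra.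
Qed.

(** Since [u x] is close to [x] and the derivative of [u] to [1], the
    derivative of [Cmod (u x) ^ 2] has the sign of [x] near [0]. *)
Lemma local_u_mono : exists d, 0 < d /\ forall x y, 0 <= x < y -> y <= d ->
  Cmod (u x) < Cmod (u y) /\ Cmod (u (- x)) < Cmod (u (- y)).
Proof.
  destruct (local_u_near (1 / 8)) as [d1 [Hd1 H1]]; [lra|].
  destruct (continuous_disc_R du 0 (local_du_continuous 0) (1 / 8))
    as [d2 [Hd2 H2]]; [lra|].
  rewrite local_du_0 in H2.
  exists (Rmin d1 (d2 / 2)). split; [apply Rmin_pos; lra|].
  assert (Hg := local_g0_neq0). assert (Hgp := local_g0_pos).
  set (N := fun x => fst (gam c (s0 + x) - z0)%C * fst (gam c (s0 + x) - z0)%C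
              + snd (gam c (s0 + x) - z0)%C * snd (gam c (s0 + x) - z0)%C).
  set (DN := fun x => 2 * (fst (gam c (s0 + x) - z0)%C * fst (dgam c (s0 + x))
              + snd (gam c (s0 + x) - z0)%C * snd (dgam c (s0 + x)))).
  assert (HN : forall x, N x = Cmod g0 * Cmod g0 * (Cmod (u x) * Cmod (u x))).
  { intros x. unfold N, u. rewrite <- Cmod_sqr, Cmod_div by auto. field. lra. }
  assert (HDN : forall x, derivable_pt_lim N x (DN x)).
  { intros x. apply is_derive_Reals. unfold N, DN. simpl.
    assert (D1 := is_derive_Cfst _ _ _ (gam_derive c (s0 + x))).
    assert (D2 := is_derive_Csnd _ _ _ (gam_derive c (s0 + x))).
    exact (is_derive_shifted_sqr (fun s => fst (gam c s))
      (fun s => snd (gam c s)) s0 x _ _ _ _ D1 D2). }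
  assert (Hsign : forall x, Rabs x <= Rmin d1 (d2 / 2) -> x <> 0 ->
    0 < x * DN x).
  { intros x Hx Hx0.
    assert (L1 : Rabs x <= d1) by (eapply Rle_trans; [exact Hx|apply Rmin_l]).
    assert (L2 : Rabs x <= d2 / 2)
      by (eapply Rle_trans; [exact Hx|apply Rmin_r]).
    specialize (H1 x L1). specialize (H2 x).
    rewrite Rminus_0_r in H2. specialize (H2 ltac:(lra)).
    assert (E : DN x = 2 * (Cmod g0 * Cmod g0) *
      (fst (u x) * fst (du x) + snd (u x) * snd (du x))).
    { unfold DN.
      replace (gam c (s0 + x) - z0)%C with (u x * g0)%C
        by (unfold u; field; auto).
      replace (dgam c (s0 + x)) with (du x * g0)%C by (unfold du; field; auto).
      rewrite Cmod_sqr. simpl. ring. }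
    rewrite E.
    assert (A1 := Rle_trans _ _ _ (fst_le_Cmod _) H1).
    assert (A2 := Rle_trans _ _ _ (snd_le_Cmod _) H1).
    assert (A3 := Rle_lt_trans _ _ _ (fst_le_Cmod _) H2).
    assert (A4 := Rle_lt_trans _ _ _ (snd_le_Cmod _) H2).
    change (Rabs (fst (u x) + - x) <= 1 / 8 * Rabs x) in A1.
    change (Rabs (snd (u x) + - 0) <= 1 / 8 * Rabs x) in A2.
    change (Rabs (fst (du x) + - (1)) < 1 / 8) in A3.
    change (Rabs (snd (du x) + - 0) < 1 / 8) in A4.
    set (u1 := fst (u x)) in *. set (u2 := snd (u x)) in *.
    set (v1 := fst (du x)) in *. set (v2 := snd (du x)) in *.
    rewrite Ropp_0, Rplus_0_r in A2, A4.
    apply Rabs_def2 in A3. apply Rabs_def2 in A4.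
    assert (Hxx : 0 < Rabs x) by (apply Rabs_pos_lt; auto).
    assert (X : Rabs x * Rabs x = x * x)
      by (symmetry; apply (Rsqr_abs x)).
    assert (B1 : Rabs (x * (u1 + - x)) <= 1 / 8 * (x * x)).
    { rewrite Rabs_mult, <- X.
      assert (Y := Rmult_le_compat_l _ _ _ (Rlt_le _ _ Hxx) A1). lra. }
    assert (B2 : Rabs (x * u2) <= 1 / 8 * (x * x)).
    { rewrite Rabs_mult, <- X.
      assert (Y := Rmult_le_compat_l _ _ _ (Rlt_le _ _ Hxx) A2). lra. }
    apply Rabs_le_between in B1. apply Rabs_le_between in B2.
    assert (Hx2 : 0 < x * x) by nra.
    assert (C1 : 7 / 8 * (x * x) <= x * u1) by lra.
    assert (C2 : 7 / 8 * (7 / 8 * (x * x)) <= x * u1 * v1) by nra.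
    assert (C3 : Rabs (x * u2 * v2) <= 1 / 8 * (x * x) * (1 / 8)).
    { rewrite Rabs_mult. apply Rmult_le_compat; try apply Rabs_pos.
      - apply Rabs_le. lra.
      - apply Rabs_le. lra. }
    apply Rabs_le_between in C3.
    replace (x * (2 * (Cmod g0 * Cmod g0) * (u1 * v1 + u2 * v2)))
      with (2 * (Cmod g0 * Cmod g0) * (x * u1 * v1 + x * u2 * v2)) by ring.
    apply Rmult_lt_0_compat; [nra|lra]. }
  assert (Hcmp : forall x y, N x < N y -> Cmod (u x) < Cmod (u y)).
  { intros x y H. rewrite !HN in H.
    apply Rmult_lt_reg_l in H; [|nra].
    generalize (Cmod_ge_0 (u x)) (Cmod_ge_0 (u y)). nra. }
  intros x y Hxy Hy. split; apply Hcmp.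
  - destruct (MVT_cor2 N DN x y) as [t [Et Ht]]; [lra|auto|].
    assert (Hs : 0 < t * DN t) by (apply Hsign; [rewrite Rabs_right|]; lra).
    assert (0 < DN t) by (apply (Rmult_lt_reg_l t); lra).
    assert (0 < DN t * (y - x)) by (apply Rmult_lt_0_compat; lra). lra.
  - destruct (MVT_cor2 N DN (- y) (- x)) as [t [Et Ht]]; [lra|auto|].
    assert (Hs : 0 < t * DN t) by (apply Hsign; [rewrite Rabs_left|]; lra).
    assert (0 < - DN t) by (apply (Rmult_lt_reg_l (- t)); lra).
    assert (0 < - DN t * (- x - - y)) by (apply Rmult_lt_0_compat; lra). lra.
Qed.

Section Density.
Variable f : C -> C.
Hypothesis Hf : continuous_along c f.

Let p (x : R) : C := (f (gam c (s0 + x)) * du x)%C.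

Lemma local_p_continuous : forall x,
  @continuous R_UniformSpace C_UniformSpace p x.
Proof.
  intros x. apply continuous_Cmult; [|apply local_du_continuous].
  apply (continuous_shifted (fun s => f (gam c s))), Hf.
Qed.

Lemma local_p_0 : p 0 = f z0.
Proof. unfold p. rewrite local_du_0, Rplus_0_r. unfold z0. ring. Qed.

Lemma local_near : forall eta, 0 < eta -> exists d, 0 < d /\
  forall x, Rabs x <= d ->
    Cmod (u x - x)%C <= eta * Rabs x /\ Cmod (p x - f z0)%C <= eta.
Proof.
  intros eta He.
  destruct (local_u_near eta He) as [d1 [Hd1 H1]].
  destruct (continuous_disc_R p 0 (local_p_continuous 0) eta He)
    as [d2 [Hd2 H2]].
  rewrite local_p_0 in H2.
  exists (Rmin d1 (d2 / 2)). split; [apply Rmin_pos; lra|].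
  intros x Hx. split.
  - apply H1. eapply Rle_trans; [exact Hx|apply Rmin_l].
  - left. apply H2. rewrite Rminus_0_r.
    assert (Rabs x <= d2 / 2) by (eapply Rle_trans; [exact Hx|apply Rmin_r]).
    lra.
Qed.

Lemma local_pole : forall (a v : C), ~ on_curve c (z0 + a * g0)%C ->
  is_contour_int c (fun t => f t / (t - (z0 + a * g0)))%C v ->
  is_CInt (fun x => (p x * / (u x - a))%C) (- Q) Q v.
Proof.
  intros a v Ha Hv. apply (contour_int_centred c _ s0) in Hv.
  apply is_CInt_ext with (3 := Hv); [generalize (period_gt0 c); lra|].
  intros x _. unfold p, u, du.
  assert (Hn := off_curve_sub_neq0 c _ (s0 + x) Ha).
  field. repeat split; try apply local_g0_neq0; auto.
  intros H. apply Hn. rewrite <- H. ring.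
Qed.

Lemma local_truncated : forall (h : R) (T : C), 0 < h ->
  is_CInt (fun x => (p x * (if Rle_dec h (Cmod (u x)) then / u x else 0))%C)
    (- Q) Q T ->
  is_contour_int c
    (fun t => if Rle_dec (h * Cmod g0) (Cmod (t - z0)%C)
              then (f t / (t - z0))%C else 0%C) T.
Proof.
  intros h T Hh HT. apply (contour_int_centred c _ s0).
  assert (Hg := local_g0_neq0). assert (Hgp := local_g0_pos).
  apply is_CInt_ext with (3 := HT); [generalize (period_gt0 c); unfold Q, P; lra|].
  intros x _.
  assert (E : Cmod (gam c (s0 + x) - z0)%C = Cmod (u x) * Cmod g0).
  { unfold u. rewrite Cmod_div by auto. field. lra. }
  rewrite E.
  destruct (Rle_dec h (Cmod (u x))) as [H1|H1];
    destruct (Rle_dec (h * Cmod g0) (Cmod (u x) * Cmod g0)) as [H2|H2].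
  - unfold p, u, du.
    assert (Hn : (gam c (s0 + x) - z0)%C <> 0%C)
      by (apply Cmod_gt_0; rewrite E; apply Rmult_lt_0_compat; lra).
    field. auto.
  - destruct H2. apply Rmult_le_compat_r; lra.
  - destruct H1. apply (Rmult_le_reg_r (Cmod g0)); auto.
  - ring.
Qed.

End Density.

(** In the local coordinate the curve runs along the real axis towards the
    right, so that [h * Ci] lies on its left and [- (h * Ci)] on its right. *)
Definition left_point (h : R) : C := (z0 + h * Ci * g0)%C.
Definition right_point (h : R) : C := (z0 + - (h * Ci) * g0)%C.

Lemma left_point_distance : forall h, 0 < h ->
  Cmod (left_point h - z0)%C = h * Cmod g0.
Proof.
  intros h Hh. unfold left_point.
  replace (z0 + h * Ci * g0 - z0)%C with (h * Ci * g0)%C by ring.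
  rewrite !Cmod_mult, Cmod_Ci, Cmod_R, Rabs_right by lra. ring.
Qed.

Lemma right_point_distance : forall h, 0 < h ->
  Cmod (right_point h - z0)%C = h * Cmod g0.
Proof.
  intros h Hh. unfold right_point.
  replace (z0 + - (h * Ci) * g0 - z0)%C with (- (h * Ci * g0))%C by ring.
  rewrite Cmod_opp, !Cmod_mult, Cmod_Ci, Cmod_R, Rabs_right by lra. ring.
Qed.

Lemma local_off_curve : forall a : C,
  (forall x, - Q <= x <= Q -> (u x - a)%C <> 0%C) ->
  ~ on_curve c (z0 + a * g0)%C.
Proof.
  intros a Ha [s Hs].
  destruct (period_reduction P (s0 - Q) s (period_gt0 c)) as [k Hk].
  apply (Ha (s + IZR k * P - s0)); [unfold Q in *; lra|].
  unfold u. replace (s0 + (s + IZR k * P - s0)) with (s + IZR k * P) by ring.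
  rewrite (periodic_Z C (gam c) _ (gam_periodic c)), Hs.
  field. apply local_g0_neq0.
Qed.

Lemma normal_points_off_curve : exists h0, 0 < h0 /\ forall h, 0 < h < h0 ->
  ~ on_curve c (left_point h) /\ ~ on_curve c (right_point h).
Proof.
  destruct (symmetric_points_off u du 1%C Q) as [h0 [Hh0 H]].
  - intros eta He. destruct (local_near (fun _ => 1%C)
      (fun s => continuous_Cconst _ _) eta He) as [d [Hd Hl]].
    exists d. split; auto. intros x Hx. destruct (Hl x Hx) as [H1 H2].
    split; auto. replace (du x) with (1 * du x)%C by ring. exact H2.
  - apply local_u_far.
  - exists h0. split; auto. intros h Hh. split; apply local_off_curve;
      intros x Hx; destruct (H h Hh x Hx) as [H1 H2]; auto.
    replace (u x - - (h * Ci))%C with (u x + h * Ci)%C by ring. exact H2.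
Qed.

(** For the constant [1] the density is the derivative of [u], with value [1]
    at [0], so the jump of the Cauchy integral is the mass of the kernel. *)
Lemma winding_jump : exists h0, 0 < h0 /\ forall h, 0 < h < h0 ->
  Cmod (winding c (left_point h) - winding c (right_point h)
        - 2 * PI * Ci)%C <= 1.
Proof.
  assert (H1c : continuous_along c (fun _ => 1%C))
    by (intros s; apply continuous_Cconst).
  destruct normal_points_off_curve as [h1 [Hh1 Hoff]].
  destruct (jump_limit u _ 1%C Q local_Q_pos
    (local_p_continuous _ H1c) (local_near _ H1c) local_u_far 1)
    as [h2 [Hh2 Hj]]; [lra|].
  exists (Rmin h1 h2). split; [apply Rmin_pos; auto|]. intros h [Hh Hlt].
  assert (L1 : h < h1) by (eapply Rlt_le_trans; [exact Hlt|apply Rmin_l]).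
  assert (L2 : h < h2) by (eapply Rlt_le_trans; [exact Hlt|apply Rmin_r]).
  destruct (Hoff h (conj Hh L1)) as [Ol Or].
  assert (W : forall z, ~ on_curve c z ->
    is_contour_int c (fun t => 1 / (t - z))%C (winding c z)).
  { intros z Hz. apply is_CInt_ext with (3 := contour_int_spec c _
      (continuous_along_inv c z Hz)); [left; apply period_gt0|].
    intros s _. unfold Cdiv. ring. }
  assert (Il := local_pole _ _ _ Ol (W _ Ol)).
  assert (Ir := local_pole _ _ _ Or (W _ Or)).
  replace (winding c (left_point h) - winding c (right_point h) - 2 * PI * Ci)%C
    with (winding c (left_point h) - winding c (right_point h)
          - 2 * PI * Ci * 1)%C by ring.
  apply (Hj h); auto.
  apply is_CInt_ext with (3 := Ir); [generalize (period_gt0 c); unfold Q, P; lra|].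
  intros x _. replace (u x - - (h * Ci))%C with (u x + h * Ci)%C by ring.
  reflexivity.
Qed.

(** The winding number is [0] outside and, by orientation, [1] inside, so an
    increase by [1] from right to left leaves only one possibility. This takes
    the place of the Jordan curve theorem. *)
Lemma normal_points_sides : counterclockwise c ->
  exists h0, 0 < h0 /\ forall h, 0 < h < h0 ->
    inside c (left_point h) /\ outside c (right_point h).
Proof.
  intros Hc.
  destruct normal_points_off_curve as [h1 [Hh1 Hoff]].
  destruct winding_jump as [h2 [Hh2 Hj]].
  exists (Rmin h1 h2). split; [apply Rmin_pos; auto|]. intros h [Hh Hlt].
  assert (L1 : h < h1) by (eapply Rlt_le_trans; [exact Hlt|apply Rmin_l]).
  assert (L2 : h < h2) by (eapply Rlt_le_trans; [exact Hlt|apply Rmin_r]).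
  destruct (Hoff h (conj Hh L1)) as [Ol Or].
  specialize (Hj h (conj Hh L2)).
  assert (HPI : 3 < PI) by (generalize PI2_3_2; unfold PI2; lra).
  assert (H2 : Cmod (2 * PI * Ci)%C = 2 * PI).
  { rewrite !Cmod_mult, Cmod_Ci, !Cmod_R, !Rabs_right by lra. ring. }
  destruct (inside_or_outside c _ Ol) as [Hl|Hl];
    destruct (inside_or_outside c _ Or) as [Hr|Hr]; auto; exfalso.
  - rewrite (winding_inside c _ Hc Hl), (winding_inside c _ Hc Hr) in Hj.
    replace (2 * PI * Ci - 2 * PI * Ci - 2 * PI * Ci)%C
      with (- (2 * PI * Ci))%C in Hj by ring.
    rewrite Cmod_opp in Hj. lra.
  - rewrite (winding_outside c _ Hl), (winding_inside c _ Hc Hr) in Hj.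
    replace (0 - 2 * PI * Ci - 2 * PI * Ci)%C
      with (2 * - (2 * PI * Ci))%C in Hj by ring.
    rewrite Cmod_mult, Cmod_opp, Cmod_R, Rabs_right in Hj by lra. lra.
  - rewrite (winding_outside c _ Hl), (winding_outside c _ Hr) in Hj.
    replace (0 - 0 - 2 * PI * Ci)%C with (- (2 * PI * Ci))%C in Hj by ring.
    rewrite Cmod_opp in Hj. lra.
Qed.

(** By the symmetric estimate, a Cauchy integral truncated at distance
    [h * Cmod g0] is close to the mean of its values at the two normal points
    at that distance, which are [0] and nearly [L]. For a merely continuous
    density, knowing both one-sided limits is what makes the truncated
    integrals converge. *)
Lemma principal_value_of_limits : counterclockwise c ->
  forall (f : C -> C) (L : C), continuous_along c f ->
  (forall z, inside c z -> contour_int c (fun t => f t / (t - z))%C = 0%C) ->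
  (forall e, 0 < e -> exists d, 0 < d /\ forall z, outside c z ->
     Cmod (z - z0)%C < d ->
     Cmod (contour_int c (fun t => f t / (t - z))%C - L)%C <= e) ->
  is_pv c (fun t => f t / (t - z0))%C z0 (L / 2)%C.
Proof.
  intros Hc f L Hf Hin Hout A HA.
  assert (HQ := local_Q_pos). assert (Hgp := local_g0_pos).
  apply locally_disc in HA. destruct HA as [e [He HA]].
  destruct (Hout (e / 2)) as [d1 [Hd1 Ho]]; [lra|].
  destruct (normal_points_sides Hc) as [h1 [Hh1 Hsides]].
  assert (Hp := local_p_continuous f Hf).
  destruct (symmetric_limit u _ (f z0) Q HQ local_u_continuous Hp
    (local_near f Hf) local_u_far local_u_mono (e / 2))
    as [h2 [Hh2 Hs]]; [lra|].
  destruct (ex_CInt_truncated u _ (f z0) Q HQ local_u_continuous Hp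
    (local_near f Hf) local_u_far local_u_mono) as [h3 [Hh3 Ht]].
  set (h0 := Rmin (Rmin h1 h2) (Rmin h3 (d1 / Cmod g0))).
  assert (Hd1' : 0 < d1 / Cmod g0) by (apply Rdiv_lt_0_compat; auto).
  assert (Hh0 : 0 < h0) by (repeat apply Rmin_pos; auto).
  assert (L1 : h0 <= h1) by (eapply Rle_trans; [apply Rmin_l|apply Rmin_l]).
  assert (L2 : h0 <= h2) by (eapply Rle_trans; [apply Rmin_l|apply Rmin_r]).
  assert (L3 : h0 <= h3) by (eapply Rle_trans; [apply Rmin_r|apply Rmin_l]).
  assert (L4 : h0 <= d1 / Cmod g0)
    by (eapply Rle_trans; [apply Rmin_r|apply Rmin_r]).
  assert (Hpos : 0 < h0 * Cmod g0) by (apply Rmult_lt_0_compat; auto).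
  exists (mkposreal _ Hpos). intros y Hy Hy0. simpl in y.
  change (Rabs (y - 0) < h0 * Cmod g0) in Hy.
  rewrite Rminus_0_r, Rabs_right in Hy by lra.
  set (h := y / Cmod g0).
  assert (Hh : 0 < h) by (apply Rdiv_lt_0_compat; auto).
  assert (Ey : y = h * Cmod g0).
  { unfold h, Rdiv. rewrite Rmult_assoc, Rinv_l, Rmult_1_r; lra. }
  assert (Hlt : h < h0) by (apply (Rmult_lt_reg_r (Cmod g0)); lra).
  destruct (Hsides h ltac:(lra)) as [Hl Hr].
  destruct (Ht h ltac:(lra)) as [T HT].
  exists T. split.
  - rewrite Ey. apply local_truncated; auto.
  - apply HA.
    assert (Il := local_pole f _ _ (proj1 Hl) (contour_int_spec c _
      (continuous_along_pole c f _ Hf (proj1 Hl)))).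
    assert (Ir := local_pole f _ _ (proj1 Hr) (contour_int_spec c _
      (continuous_along_pole c f _ Hf (proj1 Hr)))).
    fold (left_point h) in Il. fold (right_point h) in Ir.
    rewrite (Hin _ Hl) in Il.
    assert (Ir' : is_CInt (fun x => (f (gam c (s0 + x)) * du x
        * / (u x + h * Ci))%C) (- Q) Q
        (contour_int c (fun t => f t / (t - right_point h))%C)).
    { apply is_CInt_ext with (3 := Ir); [lra|]. intros x _.
      replace (u x - - (h * Ci))%C with (u x + h * Ci)%C by ring.
      reflexivity. }
    assert (B1 := Hs h _ _ _ ltac:(lra) Il Ir' HT).
    assert (B2 : Cmod (contour_int c (fun t => f t / (t - right_point h))%C
                       - L)%C <= e / 2).
    { apply Ho; auto. rewrite right_point_distance by auto.
      apply Rlt_le_trans with (h0 * Cmod g0); [lra|].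
      apply (Rmult_le_compat_r (Cmod g0)) in L4; [|lra].
      unfold Rdiv in L4. rewrite Rmult_assoc, Rinv_l, Rmult_1_r in L4; lra. }
    set (V := contour_int c (fun t => f t / (t - right_point h))%C) in *.
    replace (T - L / 2)%C with (/ 2 * ((V - L) - (0 + V - 2 * T)))%C
      by (field; apply RtoC_neq; lra).
    rewrite Cmod_mult, Cmod_inv, Cmod_R, Rabs_right
      by (try apply RtoC_neq; lra).
    eapply Rle_lt_trans; [apply Rmult_le_compat_l;
      [lra|apply Cmod_sub_le]|]. lra.
Qed.

End LocalParameter.

(** * Continuity up to the curve *)

Lemma within_proper : forall (D : C -> Prop) z,
  (forall d, 0 < d -> exists w, D w /\ Cmod (w - z)%C < d) ->
  ProperFilter' (within D (@locally C_UniformSpace z)).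
Proof.
  intros D z HD. constructor; [|apply within_filter, locally_filter].
  intros H. apply locally_disc in H. destruct H as [d [Hd H]].
  destruct (HD d Hd) as [w [Hw Hwz]]. exact (H w Hwz Hw).
Qed.

(** The points of the normal show that both domains come arbitrarily close to
    every point of the curve, so that limits from either side are unique. *)
Lemma sides_near_curve : forall c z, counterclockwise c -> on_curve c z ->
  forall d, 0 < d ->
    (exists w, inside c w /\ Cmod (w - z)%C < d) /\
    (exists w, outside c w /\ Cmod (w - z)%C < d).
Proof.
  intros c z Hc [s <-] d Hd.
  destruct (normal_points_sides c s Hc) as [h0 [Hh0 Hs]].
  destruct (small_multiple (Cmod (dgam c s)) (d / 2)) as [h1 [Hh1 Hm]]; [lra|].
  assert (Hmin : 0 < Rmin h0 h1) by (apply Rmin_pos; auto).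
  assert (A1 := Rmin_l h0 h1). assert (A2 := Rmin_r h0 h1).
  set (h := Rmin h0 h1 / 2).
  assert (B0 : 0 < h < h0) by (unfold h; lra).
  assert (B1 : 0 < h < h1) by (unfold h; lra).
  specialize (Hm h B1). destruct (Hs h B0) as [Hl Hr]. split.
  - exists (left_point c s h). split; auto.
    rewrite left_point_distance; lra.
  - exists (right_point c s h). split; auto.
    rewrite right_point_distance; lra.
Qed.

Lemma extend_from_on_curve : forall c (D : C -> Prop) (f : C -> C) z l,
  on_curve c z ->
  ProperFilter' (within D (@locally C_UniformSpace z)) ->
  (forall e, 0 < e -> exists d, 0 < d /\ forall w, D w ->
     Cmod (w - z)%C < d -> Cmod (f w - l)%C < e) ->
  extend_from c D f z = l.
Proof.
  intros c D f z l Hz HF Hlim. unfold extend_from.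
  destruct (excluded_middle_informative (on_curve c z)) as [_|H];
    [|contradiction].
  apply (iota_filterlim_locally (V := C_CompleteNormedModule)); auto.
  intros B HB.
  apply (locally_disc l) in HB. destruct HB as [e [He HB]].
  destruct (Hlim e He) as [d [Hd Hw]].
  apply disc_locally with d; auto.
Qed.

Lemma extend_from_off_curve : forall c (D : C -> Prop) (f : C -> C) z,
  ~ on_curve c z ->
  extend_from c D f z = f z.
Proof.
  intros c D f z Hz. unfold extend_from.
  destruct (excluded_middle_informative (on_curve c z)); [contradiction|auto].
Qed.

(** Small values far away and compactness of a square close up the rest; the
    points off [A] are covered by discs that miss [A]. *)
Lemma unif_continuous_of_decay : forall (A : C -> Prop) (f : C -> C),
  (forall z, ~ A z -> exists r, 0 < r /\
     forall w, Cmod (w - z)%C < r -> ~ A w) ->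
  (forall z, A z -> @continuous C_UniformSpace C_UniformSpace f z) ->
  (forall e, 0 < e -> exists r, 0 < r /\
     forall z, A z -> r <= Cmod z -> Cmod (f z) <= e) ->
  unif_continuous_on A f.
Proof.
  intros A f Hcl Hcont Hdec e He.
  assert (Hpt : forall z, exists r : posreal, forall w w', A w -> A w' ->
    Cmod (w - z)%C < r -> Cmod (w' - z)%C < r -> Cmod (f w - f w')%C < e).
  { intros z. destruct (excluded_middle_informative (A z)) as [Hz|Hz].
    - destruct (continuous_disc f z (Hcont z Hz) (e / 2)) as [d [Hd H]]; [lra|].
      exists (mkposreal d Hd). simpl. intros w w' _ _ Hw Hw'.
      replace (f w - f w')%C with ((f w - f z) - (f w' - f z))%C by ring.
      eapply Rle_lt_trans; [apply Cmod_sub_le|].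
      generalize (H w Hw) (H w' Hw'). lra.
    - destruct (Hcl z Hz) as [d [Hd H]].
      exists (mkposreal d Hd). simpl. intros w w' Hw _ Hwz _.
      destruct (H w Hwz Hw). }
  destruct (Hdec (e / 3)) as [r [Hr Hfar]]; [lra|].
  set (rad := fun z => proj1_sig (constructive_indefinite_description _ (Hpt z))).
  assert (Hrad : forall z w w', A w -> A w' ->
    Cmod (w - z)%C < rad z -> Cmod (w' - z)%C < rad z ->
    Cmod (f w - f w')%C < e).
  { intros z. unfold rad.
    exact (proj2_sig (constructive_indefinite_description _ (Hpt z))). }
  assert (Hq : forall x y, 0 < rad (x, y) / 4)
    by (intros x y; generalize (cond_pos (rad (x, y))); lra).
  destruct (compactness_value_2d (- (r + 1)) (r + 1) (- (r + 1)) (r + 1)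
    (fun x y => mkposreal _ (Hq x y))) as [d Hd].
  simpl in Hd.
  exists (Rmin d 1). split; [apply Rmin_pos; [apply cond_pos|lra]|].
  intros z w Hz Hw Hzw.
  assert (Z1 : Cmod (z - w)%C < d)
    by (eapply Rlt_le_trans; [exact Hzw|apply Rmin_l]).
  assert (Z2 : Cmod (z - w)%C < 1)
    by (eapply Rlt_le_trans; [exact Hzw|apply Rmin_r]).
  destruct (Rle_dec (Cmod z) (r + 1)) as [Hzr|Hzr].
  - destruct (Rlt_dec (Cmod (f z - f w)%C) e) as [|Hne]; auto. exfalso.
    assert (X1 := Rle_trans _ _ _ (fst_le_Cmod z) Hzr).
    assert (X2 := Rle_trans _ _ _ (snd_le_Cmod z) Hzr).
    apply Rabs_le_between in X1. apply Rabs_le_between in X2.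
    apply (Hd (fst z) (snd z) X1 X2).
    intros (a & b & _ & _ & B1 & B2 & B3). apply Hne.
    assert (B4 : Cmod (z - (a, b))%C <= rad (a, b) / 4 + rad (a, b) / 4).
    { eapply Rle_trans; [apply Cmod_le_sum|].
      change (Rabs (fst z - a) + Rabs (snd z - b)
              <= rad (a, b) / 4 + rad (a, b) / 4). lra. }
    assert (B5 := cond_pos (rad (a, b))).
    apply (Hrad (a, b)); auto; [lra|].
    replace (w - (a, b))%C with ((z - (a, b)) - (z - w))%C by ring.
    eapply Rle_lt_trans; [apply Cmod_sub_le|]. lra.
  - assert (Hwr : r <= Cmod w).
    { generalize (Cmod_triangle_sub z w). lra. }
    eapply Rle_lt_trans; [apply Cmod_sub_le|].
    generalize (Hfar z Hz ltac:(lra)) (Hfar w Hw Hwr). lra.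
Qed.

Lemma closed_outside_closed : forall c z, counterclockwise c ->
  ~ closed_outside c z -> exists r, 0 < r /\
    forall w, Cmod (w - z)%C < r -> ~ closed_outside c w.
Proof.
  intros c z Hc Hz.
  assert (Hoff : ~ on_curve c z) by (intros H; apply Hz; right; auto).
  destruct (inside_or_outside c z Hoff) as [Hin|Hout].
  - destruct (inside_open c z Hc Hin) as [r [Hr H]].
    exists r. split; auto. intros w Hw [[_ H1]|H1]; destruct (H w Hw); auto.
  - destruct Hz. left. auto.
Qed.

Lemma J_minus_contour_int : forall c F k z,
  contour_int c (fun t => Cderive_n k F t / (t - z))%C
  = (- (2 * PI * Ci) * J_minus c F k z)%C.
Proof.
  intros c F k z. unfold J_minus.
  set (I := contour_int _ _).
  replace (- 1 / (2 * PI * Ci) * I)%C with (- (/ (2 * PI * Ci) * I))%C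
    by (unfold Cdiv; ring).
  transitivity ((2 * PI * Ci) * / (2 * PI * Ci) * I)%C; [|ring].
  rewrite Cinv_r by apply two_pi_i_neq0. ring.
Qed.

Theorem theorem10 :
  forall (c : jordan_curve) (n : nat) (F : C -> C),
  counterclockwise c ->
  complement_function c n F ->
  (forall k, (k <= n)%nat ->
     (forall z, outside c z -> J_minus c F k z = Cderive_n k F z) /\
     (forall z, inside c z -> J_minus c F k z = 0%C)) ->
  forall k, (k <= n)%nat ->
    unif_continuous_on (closed_outside c) (Cderive_n k F) /\
    (exists pv : C -> C,
       (forall z0, on_curve c z0 ->
          is_pv c (fun t => Cderive_n k F t / (t - z0))%C z0 (pv z0)) /\
       unif_limit_on_curve c (inside c) (J_minus c F k)
         (fun z0 => - (1 / 2) * Cderive_n k F z0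
                    - 1 / (2 * PI * Ci) * pv z0)%C /\
       unif_limit_on_curve c (outside c) (J_minus c F k)
         (fun z0 => 1 / 2 * Cderive_n k F z0
                    - 1 / (2 * PI * Ci) * pv z0)%C) /\
    (forall z, closed_outside c z ->
       (extend_from c (outside c) (J_minus c F k) z - Cderive_n k F z)%C = 0%C) /\
    (forall z, closed_inside c z ->
       extend_from c (inside c) (J_minus c F k) z = 0%C).
Proof.
  intros c n F Hc [[N [_ [HN Hreg]]] _] HJ k Hk.
  destruct (HJ k Hk) as [Jout Jin].
  set (f := Cderive_n k F) in *.
  assert (Hcont : forall z, closed_outside c z ->
    @continuous C_UniformSpace C_UniformSpace f z).
  { intros z Hz. apply (Hreg z); auto. destruct Hz; auto. }
  assert (Halong : continuous_along c f).
  { intros s. apply (continuous_comp (gam c) f); [apply gam_continuous|].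
    apply Hcont. right. exists s. auto. }
  assert (Hpi : 0 < 2 * PI) by (generalize PI_RGT_0; lra).
  assert (Huc : unif_continuous_on (closed_outside c) f).
  { apply unif_continuous_of_decay; auto.
    - intros z. apply closed_outside_closed, Hc.
    - intros e He.
      destruct (cauchy_integral_decay c f Halong (2 * PI * e))
        as [r [Hr Hd]]; [apply Rmult_lt_0_compat; auto|].
      exists r. split; auto. intros z Hz Hrz.
      destruct (Hd z Hrz) as [Hoff Hb].
      assert (Hout : outside c z) by (destruct Hz; [auto|contradiction]).
      unfold f in Hb. rewrite J_minus_contour_int, Jout in Hb by auto.
      rewrite Cmod_mult, Cmod_opp, !Cmod_mult, Cmod_Ci, !Cmod_R in Hb.
      rewrite (Rabs_right 2), (Rabs_right PI), Rmult_1_r in Hb by lra.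
      apply Rmult_le_reg_l in Hb; auto. }
  assert (Hlim : unif_limit_on_curve c (outside c) (J_minus c F k) f).
  { intros e He. destruct (Huc e He) as [d [Hd H]]. exists d. split; auto.
    intros z0 z Hz0 Hz Hzz. rewrite Jout by auto.
    apply H; auto; [left|right]; auto. }
  assert (Hpv : forall z0,
    (- (1 / 2) * f z0 - 1 / (2 * PI * Ci) * (- (2 * PI * Ci) * f z0 / 2) = 0 /\
     1 / 2 * f z0 - 1 / (2 * PI * Ci) * (- (2 * PI * Ci) * f z0 / 2) = f z0)%C).
  { intros z0.
    assert (H : (1 / (2 * PI * Ci) * (- (2 * PI * Ci) * f z0 / 2)
                 = - (1 / 2) * f z0)%C).
    { unfold Cdiv. transitivity
        (- ((2 * PI * Ci) * / (2 * PI * Ci)) * / 2 * f z0)%C; [ring|].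
      rewrite Cinv_r by apply two_pi_i_neq0. ring. }
    rewrite H. split; [ring|field]. }
  split; [exact Huc|split; [|split]].
  - exists (fun z0 => - (2 * PI * Ci) * f z0 / 2)%C. split; [|split].
    + intros z0 [s <-]. apply principal_value_of_limits; auto.
      * intros z Hz. unfold f. rewrite J_minus_contour_int, Jin by auto. ring.
      * intros e He.
        destruct (small_multiple (2 * PI) e He) as [e' [He' Hs]].
        destruct (Hlim (e' / 2)) as [d [Hd H]]; [lra|].
        exists d. split; auto. intros z Hz Hzs.
        unfold f at 1. rewrite J_minus_contour_int.
        replace (- (2 * PI * Ci) * J_minus c F k z
                 - - (2 * PI * Ci) * f (gam c s))%C
          with (- (2 * PI * Ci) * (J_minus c F k z - f (gam c s)))%C by ring.
        rewrite Cmod_mult, Cmod_opp, !Cmod_mult, Cmod_Ci, !Cmod_R.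
        rewrite (Rabs_right 2), (Rabs_right PI), Rmult_1_r by lra.
        eapply Rle_trans; [|apply (Hs (e' / 2)); lra].
        apply Rmult_le_compat_l; [lra|]. left. apply H; auto. exists s. auto.
    + intros e He. exists 1. split; [lra|]. intros z0 z _ Hz _.
      rewrite Jin by auto. rewrite (proj1 (Hpv z0)).
      replace (0 - 0)%C with (RtoC 0) by ring. rewrite Cmod_0. auto.
    + intros e He. destruct (Hlim e He) as [d [Hd H]]. exists d. split; auto.
      intros z0 z Hz0 Hz Hzz. rewrite (proj2 (Hpv z0)). auto.
  - intros z [Hz|Hz].
    + rewrite extend_from_off_curve by apply Hz. rewrite Jout by auto. ring.
    + rewrite (extend_from_on_curve c _ _ z (f z)); auto; [ring| |].
      * apply within_proper. intros d Hd. apply sides_near_curve; auto.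
      * intros e He. destruct (Hlim e He) as [d [Hd H]]. exists d. auto.
  - intros z [Hz|Hz].
    + rewrite extend_from_off_curve by apply Hz. auto.
    + apply extend_from_on_curve; auto.
      * apply within_proper. intros d Hd. apply sides_near_curve; auto.
      * intros e He. exists 1. split; [lra|]. intros w Hw _.
        rewrite Jin by auto.
        replace (0 - 0)%C with (RtoC 0) by ring. rewrite Cmod_0. auto.
Qed.
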